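(* Let $L=\beta\cup\gamma$ be the (nonembedded) configuration of the granny clasp link-homotopy class $G_1$ built from $\tau=1$ clasp arcs, as defined in the context. Then $L$ is strongly critical for minimizing length (all weights equal to $1$) when constrained by Gehring thickness.
   Context: GENERALIZED LINKS AND CRITICALITY. A generalized link $L$ is a parametrized curve in $\mathbb{R}^3$ with finitely many, mutually disjoint components $L_i$ (arcs or closed curves; in the link-homotopy setting used here a single component may intersect itself), where each endpoint $x\in\partial L$ is constrained to stay on a given affine subspace $M_x\subset\mathbb{R}^3$, together with finitely many obstacles $\{p\in\mathbb{R}^3: g_j(p)<0\}$, with $g_j$ of class $C^1$ having $0$ as a regular value; $L$ must lie in $\{\min_j g_j\ge 0\}$. The Gehring thickness $\mathrm{GThi}(L)$ is the minimal distance between points on different components of $L$ (self-contact of one component is not seen). The Gehring ropelength problem is to minimize length subject to $\mathrm{GThi}\ge1$. A Gehring strut is an unordered pair $\{x,y\}$ of points on different components with $|x-y|=\mathrm{GThi}(L)$; a wall strut is a pair $(j,x)$ with $x\in L$, $g_j(x)=0$. A compatible vectorfield is a continuous $\xi$ along the parametrized curve $L$ (so it may take two values at a self-intersection point) with $\xi_x$ tangent to $M_x$ at each endpoint $x$. The first variation of length of a component with unit tangent $T$ (of bounded variation) is $\delta_\xi\mathrm{Len}=[T\cdot\xi]_{\mathrm{start}}^{\mathrm{end}}-\int\xi\cdot dT$ (no boundary term for closed components), and $\delta_\xi\mathrm{Len}(L)=\sum_i \delta_\xi\mathrm{Len}(L_i)$. Put $\delta^+_\xi\mathrm{GThi}(L)=\min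 (\xi_x-\xi_y)\cdot\frac{x-y}{|x-y|}$ over all Gehring struts $\{x,y\}$ (points being understood as parameter points of $L$), and $\delta^+_\xi O(L)=\min \xi_x\cdot\nabla g_j(x)$ over all wall struts $(j,x)$; these are the one-sided first variations of $\mathrm{GThi}$ and of $O(L)=\min_j\min_{x\in L}g_j(x)$. $L$ is strongly critical for minimizing length when constrained by $\mathrm{GThi}$ if there is $\varepsilon>0$ such that for all compatible $\xi$ with $\delta_\xi\mathrm{Len}(L)=-1$ we have $\min(\delta^+_\xi\mathrm{GThi}(L),\delta^+_\xi O(L))\le-\varepsilon$. $\tau=1$ CLASP ARCS. Use coordinates $(x_1,x_2,z)$ on $\mathbb{R}^3$ with $z$ vertical. For $u\in[0,1]$ set $v=1-u$ and $$X(u)=\sqrt{\frac{u^2(1-v^2)}{1-u^2v^2}},\qquad Z(u)=\int_0^u\frac{s}{\sqrt{1-s^2}}\,X'(s)\,ds,\qquad h=Z(1).$$ Note $X(0)=0$, $X(1)=1$. CONFIGURATION. Fix $c>0$. The component $\beta$ lies in the plane $x_2=0$ and is the union of a half $\beta'$ and its mirror image under $x_1\mapsto-x_1$, the two halves being joined at the tip $t=(0,0,3h)$ so that $\beta$ is one $C^1$ arc from $(1,0,-c)$ to $(-1,0,-c)$. The half $\beta'$ is the concatenation of: (1) the vertical segment from $(1,0,-c)$ to $(1,0,0)$; (2) the clasp arc $(X(u),0,h-Z(u))$, $u$ from $1$ to $0$, ending at $p=(0,0,h)$; (3) the clasp arc $(-X(u),0,h+Z(u))$, $u$ from $0$ to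 $1$, ending at $(-1,0,2h)$; (4) the clasp arc $(-X(u),0,3h-Z(u))$, $u$ from $1$ to $0$, ending at $t$. Thus $\beta$ has the point $p$ as a self-intersection. The component $\gamma$ is the image of $\beta$ under the isometry $(x_1,x_2,z)\mapsto(x_2,x_1,3h-z)$; its tip is $t'=(0,0,0)$ and its self-intersection is $p'=(0,0,2h)$. The two endpoints of $\beta$ are constrained to the floor plane $z=-c$, those of $\gamma$ to the ceiling plane $z=3h+c$, and the obstacles are given by $g=z+c$ and $g=3h+c-z$ (so $L$ must stay between floor and ceiling). The granny clasp $G_1$ is the clasp of two ropes (one with ends on the floor, one with ends on the ceiling, the endpoints free to move in these planes) based on the granny knot, i.e. the connect sum of two trefoils of the same handedness: suitably joining the free ends of the two ropes in pairs (the two at the left to each other and the two at the right to each other) yields the granny knot. It is considered up to link homotopy (homotopy keeping different components disjoint but allowing each component to cross itself). *)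

(* Defs.v *)
From HB Require Import structures.
From mathcomp Require Import all_boot all_order all_algebra.
From mathcomp Require Import all_classical all_reals all_analysis.

Set Implicit Arguments.
Unset Strict Implicit.
Unset Printing Implicit Defensive.

Import Order.TTheory GRing.Theory Num.Theory.
Import numFieldNormedType.Exports.

Local Open Scope classical_set_scope.
Local Open Scope ring_scope.

Section Euclidean.
Context {R : realType}.
Implicit Types u v p : 'rV[R]_3.

Definition dot u v : R := \sum_(i < 3) u 0 i * v 0 i.

(* The library norm on 'rV[R]_3 is the sup norm (it induces the same topology),
   hence the separate Euclidean norm. *)
Definition enorm u : R := Num.sqrt (dot u u).

Definition normalize u : 'rV[R]_3 := (enorm u)^-1 *: u.

Definition gradient (g : 'rV[R]_3 -> R) p : 'rV[R]_3 :=
  \row_(i < 3) 'D_(delta_mx 0 i) g p.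

Definition C1 (g : 'rV[R]_3 -> R) : Prop :=
  (forall p, differentiable g p) /\ continuous (gradient g).

Definition regular_value (g : 'rV[R]_3 -> R) (a : R) : Prop :=
  forall p, g p = a -> gradient g p != 0.

Record affine_subspace := AffineSubspace {
  base : 'rV[R]_3;
  direction : {vspace 'rV[R]_3} }.

Definition in_affine (M : affine_subspace) p : Prop :=
  p - base M \in direction M.

End Euclidean.
Arguments affine_subspace : clear implicits.

Section RiemannStieltjes.
Context {R : realType}.

(* [v] is the Riemann-Stieltjes integral of xi . dT over [a, b]: the limit of
   the sums over all tagged partitions a :: s of [a, b], as the mesh tends to 0.
   It exists when xi is continuous and T is of bounded variation; jumps of T at
   a and at b are taken into account. *)
Definition is_RS_integral (a b : R) (xi T : R -> 'rV[R]_3) (v : R) : Prop :=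
  forall e : R, 0 < e -> exists2 d : R, 0 < d &
    forall (s : seq R) (tag : nat -> R),
      itv_partition a b s ->
      (forall k, (k < size s)%N ->
        [/\ nth b (a :: s) k <= tag k, tag k <= nth b (a :: s) k.+1
          & nth b (a :: s) k.+1 - nth b (a :: s) k < d]) ->
      `| \sum_(0 <= k < size s)
           dot (xi (tag k)) (T (nth b (a :: s) k.+1) - T (nth b (a :: s) k))
         - v | < e.

Definition RS_integral (a b : R) (xi T : R -> 'rV[R]_3) : R :=
  get [set v | is_RS_integral a b xi T v].

End RiemannStieltjes.

(* The data of a generalized link. Component i is the curve [curve i] restricted
   to [lo i, hi i]; its endpoints, if it is an arc, are indexed by bool (false
   for the start, true for the end) and [constraint] gives the affine subspaces
   M_x; it is irrelevant for closed components. The obstacles are the sets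
   where [obstacle j] is negative. *)
Record link_data (R : realType) := LinkData {
  component : finType;
  closed_comp : component -> bool;
  lo : component -> R;
  hi : component -> R;
  curve : component -> R -> 'rV[R]_3;
  constraint : component -> bool -> affine_subspace R;
  obstacle_index : finType;
  obstacle : obstacle_index -> 'rV[R]_3 -> R }.

Section GeneralizedLinks.
Context {R : realType}.

(* Oriented unit tangents as limits of secant directions. This depends only on
   the oriented curve, so the parametrization need not be regular. *)
Definition right_tangent (f : R -> 'rV[R]_3) (s : R) : 'rV[R]_3 :=
  lim (normalize (f r - f s) @[r --> s^'+]).
Definition left_tangent (f : R -> 'rV[R]_3) (s : R) : 'rV[R]_3 :=
  lim (normalize (f s - f r) @[r --> s^'-]).

Variable L : link_data R.
Implicit Types (i : component L) (j : obstacle_index L).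

Definition endpoint i (e : bool) : R := if e then hi i else lo i.

(* At the final parameter of a closed component, which is its initial point
   again, the tangent is the one at the initial point; so a corner there
   contributes to dT. *)
Definition unit_tangent i (s : R) : 'rV[R]_3 :=
  if s < hi i then right_tangent (curve i) s
  else if closed_comp i then right_tangent (curve i) (lo i)
  else left_tangent (curve i) (hi i).

Definition tangent_of_BV i : Prop :=
  [/\ forall s, s \in `[lo i, hi i[ ->
        cvg (normalize (curve i r - curve i s) @[r --> s^'+]),
      cvg (normalize (curve i (hi i) - curve i r) @[r --> (hi i)^'-])
    & forall k : 'I_3,
        bounded_variation (lo i) (hi i) (fun s => unit_tangent i s 0 k)].

Definition generalized_link : Prop :=
  [/\ forall i, [/\ lo i < hi i,
                    {within `[lo i, hi i], continuous (curve i)},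
                    closed_comp i -> curve i (lo i) = curve i (hi i)
                  & tangent_of_BV i],
      forall i1 i2 s1 s2, i1 != i2 ->
        s1 \in `[lo i1, hi i1] -> s2 \in `[lo i2, hi i2] ->
        curve i1 s1 <> curve i2 s2,
      forall i e, ~~ closed_comp i ->
        in_affine (constraint i e) (curve i (endpoint i e)),
      forall j, C1 (obstacle j) /\ regular_value (obstacle j) 0
    & forall i j s, s \in `[lo i, hi i] -> 0 <= obstacle j (curve i s)].

Definition GThi : \bar R :=
  ereal_inf [set d | exists i1 i2 s1 s2,
    [/\ i1 != i2, s1 \in `[lo i1, hi i1], s2 \in `[lo i2, hi i2]
      & d = (enorm (curve i1 s1 - curve i2 s2))%:E]].

(* Each unordered strut is represented by its two orderings, for which the
   variation of length below is the same. *)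
Definition gehring_strut i1 (s1 : R) i2 (s2 : R) : Prop :=
  [/\ i1 != i2, s1 \in `[lo i1, hi i1], s2 \in `[lo i2, hi i2]
    & (enorm (curve i1 s1 - curve i2 s2))%:E = GThi].

Definition wall_strut j i (s : R) : Prop :=
  s \in `[lo i, hi i] /\ obstacle j (curve i s) = 0.

Definition compatible (xi : component L -> R -> 'rV[R]_3) : Prop :=
  [/\ forall i, {within `[lo i, hi i], continuous (xi i)},
      forall i, closed_comp i -> xi i (lo i) = xi i (hi i)
    & forall i e, ~~ closed_comp i ->
        xi i (endpoint i e) \in direction (constraint i e)].

Definition delta_Len_comp (xi : component L -> R -> 'rV[R]_3) i : R :=
  (if closed_comp i then 0
   else dot (unit_tangent i (hi i)) (xi i (hi i))
        - dot (unit_tangent i (lo i)) (xi i (lo i)))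
  - RS_integral (lo i) (hi i) (xi i) (unit_tangent i).

Definition delta_Len (xi : component L -> R -> 'rV[R]_3) : R :=
  \sum_(i : component L) delta_Len_comp xi i.

Definition delta_GThi (xi : component L -> R -> 'rV[R]_3) : \bar R :=
  ereal_inf [set d | exists i1 s1 i2 s2,
    gehring_strut i1 s1 i2 s2 /\
    d = (dot (xi i1 s1 - xi i2 s2)
             (normalize (curve i1 s1 - curve i2 s2)))%:E].

Definition delta_O (xi : component L -> R -> 'rV[R]_3) : \bar R :=
  ereal_inf [set d | exists j i s,
    wall_strut j i s /\
    d = (dot (xi i s) (gradient (obstacle j) (curve i s)))%:E].

Definition strongly_critical : Prop :=
  exists2 eps : R, 0 < eps &
    forall xi, compatible xi -> delta_Len xi = -1 ->
      (Order.min (delta_GThi xi) (delta_O xi) <= (- eps)%:E)%E.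

End GeneralizedLinks.

Section ClaspArc.
Context {R : realType}.

Definition clasp_X (u : R) : R :=
  let v := 1 - u in
  Num.sqrt (u ^+ 2 * (1 - v ^+ 2) / (1 - u ^+ 2 * v ^+ 2)).

Definition clasp_Z (u : R) : R :=
  \int[@lebesgue_measure R]_(s in `[0, u])
    (s / Num.sqrt (1 - s ^+ 2) * (clasp_X^`())%classic s).

Definition clasp_h : R := clasp_Z 1.

End ClaspArc.
Arguments clasp_h R : clear implicits.

Section GrannyClasp.
Context {R : realType}.
Variable c : R.
Local Notation h := (clasp_h R).

Definition vec3 (x1 x2 z : R) : 'rV[R]_3 := \row_(k < 3) [:: x1; x2; z]`_k.

Definition x1_of (p : 'rV[R]_3) : R := p 0 (inord 0).
Definition x2_of (p : 'rV[R]_3) : R := p 0 (inord 1).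
Definition z_of (p : 'rV[R]_3) : R := p 0 (inord 2).

(* The half beta', from (1, 0, -c) to the tip t, on [0, 4]; the k-th piece is
   parametrized by [k - 1, k], and the clasp parameter u runs over [0, 1] in
   the prescribed direction. *)
Definition half_beta (s : R) : 'rV[R]_3 :=
  if s <= 1 then vec3 1 0 (- c + c * s)
  else if s <= 2 then let u := 2 - s in vec3 (clasp_X u) 0 (h - clasp_Z u)
  else if s <= 3 then let u := s - 2 in vec3 (- clasp_X u) 0 (h + clasp_Z u)
  else let u := 4 - s in vec3 (- clasp_X u) 0 (3 * h - clasp_Z u).

Definition mirror (p : 'rV[R]_3) : 'rV[R]_3 :=
  vec3 (- x1_of p) (x2_of p) (z_of p).

Definition beta (s : R) : 'rV[R]_3 :=
  if s <= 4 then half_beta s else mirror (half_beta (8 - s)).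

Definition swap_flip (p : 'rV[R]_3) : 'rV[R]_3 :=
  vec3 (x2_of p) (x1_of p) (3 * h - z_of p).

Definition gamma (s : R) : 'rV[R]_3 := swap_flip (beta s).

Definition horizontal_plane (z : R) : affine_subspace R :=
  AffineSubspace (vec3 0 0 z) <<[:: vec3 1 0 0; vec3 0 1 0]>>%VS.

(* Component false is beta, with ends on the floor; component true is gamma,
   with ends on the ceiling. Obstacle false lies below the floor, obstacle true
   above the ceiling. *)
Definition granny_clasp : link_data R := {|
  component := bool;
  closed_comp := fun=> false;
  lo := fun=> 0;
  hi := fun=> 8;
  curve := fun i => if i then gamma else beta;
  constraint := fun i _ => horizontal_plane (if i then 3 * h + c else - c);
  obstacle_index := bool;
  obstacle := fun j p => if j then 3 * h + c - z_of p else z_of p + c |}.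

End GrannyClasp.

(* Main.v *)
Require Import Defs.
From mathcomp Require Import all_boot all_order all_algebra.
From mathcomp Require Import all_classical all_reals all_analysis.
From mathcomp Require Import measurable_realfun ring lra.

(** Why the configuration is strongly critical.

Write v = 1 - u and let h be the height of a clasp arc. At the parameter u of a
clasp arc the unit tangent makes with the horizontal the angle whose sine is u,
so that its coordinates are cosine u = sqrt (1 - u^2) and u up to signs, and
- dT, the force density of the tightened rope, is (slope u, 1) du with
slope u = u / cosine u. In a clasp, the point u of an arc of one rope faces the
points v of the two mirror arcs of the other rope, at the vertical distance
clasp_gap u = h - Z(u) - Z(v). This gap is both sqrt (1 - X(u)^2 - X(v)^2), which
says that facing points are at distance 1 ([clasp_gapE]), and X(u) / slope u,
which says that the two struts at u add up to a multiple of - dT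
([clasp_gap_slope]). Thus the curvature of the ropes is balanced by a positive
measure du / (2 clasp_gap u) on the struts, and this balance is criticality.

In detail, beta and gamma form three such clasps, at the heights [0, h], [h, 2h]
and [2h, 3h]. Since d/dw (X(u)^2 + X(w)^2 + (h - Z(u) - Z(w))^2) has the sign of
Z(u) - Z(1 - w), the distance is at least 1 within a clasp, with equality at
w = v ([clasp_dist]); the points of two different clasps are only further apart
([curve_dist_ge1]). Hence the Gehring thickness is 1 and facing points are
struts. Let xi be compatible, and suppose that no strut shortens at a rate
exceeding eps. Adding this for the four struts at the parameter u of a clasp,
the components of xi normal to the planes of the ropes cancel by symmetry
([clasp_strut_dot], [clasp_energy_ge]); after division by 2 clasp_gap u what
remains bounds from below the density of the contribution of the clasp to the
variation of length, by - 2 eps / clasp_gap u. As clasp_gap u, X(u) and X(v) are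
the coordinates of a unit vector, 1 / clasp_gap u is at most
1 + slope u + slope v, whose integral is 3 ([clasp_gap_slopes],
[clasp_balance]). A clasp thus contributes at least - 6 eps and the three of them
- 18 eps. The straight segments contribute nothing, and the boundary terms
vanish because the ropes meet the walls at a right angle while xi is horizontal
there ([endpoint_up]). So a variation of length of - 1 forces eps >= 1 / 18.

All integrals along the ropes are handled by primitives. The coordinates of T are
monotone on each piece, namely u or cosine u up to sign; as cosine is an
involution of [0, 1], a primitive of f with respect to d(cosine) is
(P o cosine) with P' = f o cosine. Primitives are glued at the junctions of
the pieces, and their increments are the Riemann-Stieltjes integrals
([stieltjes_primitive], [is_RS_integral_planar]). On an arc both end parameters
are singular (X' vanishes at 0, Z' is infinite at 1), so the unit tangents are
found by squeezing the secants between the tangents at their two ends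
([clasp_secant]). *)

Set Implicit Arguments.
Unset Strict Implicit.
Unset Printing Implicit Defensive.

Import Order.TTheory GRing.Theory Num.Theory.
Import numFieldNormedType.Exports.

Local Open Scope classical_set_scope.
Local Open Scope ring_scope.

(** * Riemann-Stieltjes integrals through primitives *)

Section Stieltjes.
Context {R : realType}.
Implicit Types (a b : R) (f G F : R -> R).

Local Notation TV := total_variation.
Local Notation BV := bounded_variation.

(** Uniform continuity on a segment, with the second point not confined to it. *)
Lemma continuous_segment_unif f a b (e : R) : continuous f -> 0 < e ->
  exists2 d : R, 0 < d &
    forall x y, a <= x <= b -> `|x - y| < d -> `|f x - f y| < e.
Proof.
move=> cf e0.
have /compact_near_coveringP cov := @segment_compact R a b.
have := cov R (0 : R)^'+ (fun d x => forall y, `|x - y| < d -> `|f x - f y| < e)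
  _ _.
case => [|d /= d0 H].
- move=> x _.
  have e2 : 0 < e / 2 by rewrite divr_gt0.
  have /cvgrPdist_lt/(_ _ e2) /nbhs_ballP[r /= r0 fr] := cf x.
  exists (ball x (r / 2), [set d : R | 0 < d < r / 2]) => /=.
    split; first exact: nbhsx_ballx (divr_gt0 r0 _).
    exists (r / 2) => /=; first by rewrite divr_gt0.
    move=> d /=; rewrite sub0r normrN => + d0; rewrite gtr0_norm// => dr.
    by rewrite d0.
  move=> [z d] /= [xz /andP[d0 dr]] y zy.
  have fz : `|f x - f z| < e / 2.
    by apply: fr => /=; rewrite /ball/= (lt_trans xz)//; lra.
  have fy : `|f x - f y| < e / 2.
    apply: fr => /=; rewrite /ball/= -(subrKA z).
    by rewrite (le_lt_trans (ler_normD _ _))//; move: xz; rewrite /ball/=; lra.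
  rewrite -(subrKA (f x)) (le_lt_trans (ler_normD _ _))// distrC.
  lra.
- exists (d / 2); first by rewrite divr_gt0.
  move=> x y xab xy; apply: (H (d / 2)) => //=.
  + by rewrite sub0r normrN gtr0_norm ?divr_gt0//; lra.
  + by rewrite divr_gt0.
Qed.

(** F plays the role of the indefinite integral of f with respect to dG. The error
    is measured by the total variation of G, which makes the property additive over
    adjacent intervals; a mean value property of F would not be. *)
Definition stieltjes_primitive a b f G F : Prop :=
  forall x y m e, a <= x -> x <= y -> y <= b ->
    (forall t, x <= t <= y -> `|f t - m| <= e) ->
    (`|F y - F x - m * (G y - G x)|%:E <= e%:E * TV x y G)%E.

Definition has_stieltjes a b f G (v : R) : Prop :=
  exists2 F, stieltjes_primitive a b f G F & F b - F a = v.

Lemma has_stieltjes_mean_value a b f G F :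
  (forall x y, a <= x -> x <= y -> y <= b ->
    exists2 t, x <= t <= y & F y - F x = f t * (G y - G x)) ->
  has_stieltjes a b f G (F b - F a).
Proof.
move=> mvF; exists F => // x y m e ax xy yb fm.
have [t txy ->] := mvF _ _ ax xy yb.
have e0 : 0 <= e by apply: le_trans (fm x _); rewrite ?lexx.
rewrite -mulrBl normrM EFinM.
apply: (@le_trans _ _ (e%:E * `|G y - G x|%:E)%E).
  by rewrite -!EFinM lee_fin ler_wpM2r// fm.
by rewrite lee_wpmul2l ?lee_fin//; exact: total_variation_ge.
Qed.

(** The two primitives are shifted so as to agree at b; an interval that straddles
    b is cut there, and total variation is additive. *)
Lemma has_stieltjes_cat a b d f G v w : a <= b -> b <= d ->
  has_stieltjes a b f G v -> has_stieltjes b d f G w ->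
  has_stieltjes a d f G (v + w).
Proof.
move=> ab bd [F pF <-] [H pH <-].
pose K s := if s <= b then F s - F b else H s - H b.
have KF s : s <= b -> K s = F s - F b by rewrite /K => ->.
have KH s : b <= s -> K s = H s - H b.
  by rewrite le_eqVlt => /predU1P[<-|bs]; rewrite /K ?lexx ?subrr// leNgt bs.
have KFl x y m e : a <= x -> x <= y -> y <= b ->
    (forall t, x <= t <= y -> `|f t - m| <= e) ->
    (`|K y - K x - m * (G y - G x)|%:E <= e%:E * TV x y G)%E.
  move=> ax xy yb fm; rewrite !KF//; last exact: le_trans xy yb.
  have -> : F y - F b - (F x - F b) = F y - F x by ring.
  exact: pF.
have KHr x y m e : b <= x -> x <= y -> y <= d ->
    (forall t, x <= t <= y -> `|f t - m| <= e) ->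
    (`|K y - K x - m * (G y - G x)|%:E <= e%:E * TV x y G)%E.
  move=> bx xy yd fm; rewrite !KH//; last exact: le_trans bx xy.
  have -> : H y - H b - (H x - H b) = H y - H x by ring.
  exact: pH.
exists K; last by rewrite KH// KF//; ring.
move=> x y m e ax xy yd fm.
have [yb|/ltW by_] := leP y b; first exact: KFl.
have [bx|/ltW xb] := leP b x; first exact: KHr.
rewrite (total_variationD _ xb by_) ge0_muleDr ?total_variation_ge0//.
have -> : K y - K x - m * (G y - G x) =
  (K b - K x - m * (G b - G x)) + (K y - K b - m * (G y - G b)) by ring.
apply: (@le_trans _ _ (`|K b - K x - m * (G b - G x)|%:E +
   `|K y - K b - m * (G y - G b)|%:E)%E).
  by rewrite -EFinD lee_fin ler_normD.
apply: leeD.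
- by apply: KFl => // t /andP[xt tb]; apply: fm; rewrite xt (le_trans tb).
- by apply: KHr => // t /andP[bt ty]; apply: fm; rewrite ty (le_trans xb).
Qed.

(** A partition sum differs from F b - F a by at most the oscillation of f on the
    pieces times the total variation of G: each piece is an instance of the
    estimate that defines a primitive. *)
Lemma stieltjes_sum_le a b f G F (d e : R) (s : seq R) (tag : nat -> R) :
  stieltjes_primitive a b f G F ->
  (forall x y, a <= x <= b -> `|x - y| < d -> `|f x - f y| < e) ->
  itv_partition a b s ->
  (forall k, (k < size s)%N ->
    [/\ nth b (a :: s) k <= tag k, tag k <= nth b (a :: s) k.+1
      & nth b (a :: s) k.+1 - nth b (a :: s) k < d]) ->
  (`| \sum_(0 <= k < size s)
       f (tag k) * (G (nth b (a :: s) k.+1) - G (nth b (a :: s) k))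
      - (F b - F a) |%:E <= e%:E * TV a b G)%E.
Proof.
elim: s a tag => [|x s ih] a tag pF uf abs tags.
  have <- := itv_partition_nil abs.
  by rewrite big_nil subrr subr0 normr0 total_variationxx mule0.
have ax : a < x by case: abs => /= /andP[].
have xs := itv_partition_cons abs.
have xb := itv_partition_le xs.
have [/= at0 t0x xad] := tags 0%N isT.
rewrite (total_variationD _ (ltW ax) xb).
rewrite ge0_muleDr ?total_variation_ge0//; last exact: ltW.
rewrite big_nat_recl//=.
under eq_bigr do rewrite /=.
set S := \sum_(0 <= i < size s) _.
have -> : f (tag 0%N) * (G x - G a) + S - (F b - F a) =
  - (F x - F a - f (tag 0%N) * (G x - G a)) + (S - (F b - F x)) by ring.
apply: (@le_trans _ _ (`|F x - F a - f (tag 0%N) * (G x - G a)|%:E +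
    `|S - (F b - F x)|%:E)%E).
  by rewrite -EFinD lee_fin (le_trans (ler_normD _ _))// normrN.
apply: leeD.
- apply: pF => //; first exact: ltW.
  move=> t /andP[at_ tx]; apply/ltW/uf; first by rewrite at_ (le_trans tx).
  by rewrite ltr_norml; apply/andP; split; lra.
- apply: (ih x (fun k => tag k.+1)) => //.
  + by move=> y z m r xy; apply: pF; exact: le_trans (ltW ax) xy.
  + by move=> y z /andP[xy yb]; apply: uf; rewrite (le_trans (ltW ax) xy).
  + by move=> k ks; exact: (tags k.+1).
Qed.

Lemma stieltjes_sum_cvg a b f G v : continuous f -> BV a b G -> a <= b ->
  has_stieltjes a b f G v ->
  forall e : R, 0 < e -> exists2 d : R, 0 < d &
    forall (s : seq R) (tag : nat -> R),
      itv_partition a b s ->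
      (forall k, (k < size s)%N ->
        [/\ nth b (a :: s) k <= tag k, tag k <= nth b (a :: s) k.+1
          & nth b (a :: s) k.+1 - nth b (a :: s) k < d]) ->
      `| \sum_(0 <= k < size s)
           f (tag k) * (G (nth b (a :: s) k.+1) - G (nth b (a :: s) k))
         - v | < e.
Proof.
move=> cf bG ab [F pF <-] e e0.
have fin : TV a b G \is a fin_num by apply/bounded_variationP.
have V0 : 0 <= fine (TV a b G) by rewrite fine_ge0// total_variation_ge0.
pose r := e / (fine (TV a b G) + 1).
have r0 : 0 < r by rewrite divr_gt0// ltr_wpDl.
have [d d0 uf] := continuous_segment_unif a b cf r0.
exists d => // s tag abs tags.
have := stieltjes_sum_le pF uf abs tags.
rewrite -(fineK fin) -EFinM lee_fin => /le_lt_trans; apply.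
rewrite /r mulrAC ltr_pdivrMr ?ltr_wpDl// ltr_pM2l//.
by rewrite ltrDl.
Qed.

(** Guarantees that the Riemann-Stieltjes integral is unique: with no fine tagged
    partition, every number would be an integral. *)
Lemma fine_partition a b d : a < b -> 0 < d -> exists2 s : seq R,
  itv_partition a b s & forall k, (k < size s)%N ->
    [/\ nth b (a :: s) k <= nth b (a :: s) k.+1
      & nth b (a :: s) k.+1 - nth b (a :: s) k < d].
Proof.
move=> + d0.
have d2 : 0 < d / 2 by rewrite divr_gt0.
have := truncnS_gt ((b - a) / (d / 2)); set n := (Num.trunc _).+1; clearbody n.
rewrite ltr_pdivrMr// => /ltW; elim: n a => [|n ih] a bad ab.
  by move: bad ab; rewrite mul0r subr_le0 leNgt => /negbTE ->.
have [small|big] := ltP (b - a) d.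
  exists [:: b]; first exact: itv_partition1.
  by case=> //= _; rewrite (ltW ab).
have [||s [ps ls] mesh] := ih (a + d / 2).
- by move: bad; rewrite -natr1 mulrDl mul1r; lra.
- lra.
exists (a + d / 2 :: s); first by split => //=; rewrite ps ltrDl d2.
case => [_|k ks] /=; last exact: mesh.
by split; [rewrite lerDl ltW|lra].
Qed.

Lemma is_RS_integral_unique a b (xi T : R -> 'rV[R]_3) v : a < b ->
  is_RS_integral a b xi T v -> RS_integral a b xi T = v.
Proof.
move=> ab vP; apply/eqP/negPn/negP => nvw; set w := RS_integral a b xi T in nvw.
have wP : is_RS_integral a b xi T w by exact: (getI vP).
have e0 : 0 < `|w - v| / 2 by rewrite divr_gt0// normr_gt0 subr_eq0.
have [d1 d10 H1] := vP _ e0; have [d2 d20 H2] := wP _ e0.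
have [|s abs mesh] := @fine_partition a b (Num.min d1 d2) ab.
  by rewrite lt_min d10.
pose tag k := nth b (a :: s) k.
have := H1 s tag abs; set S := \sum_(_ <= _ < _) _ => {}H1.
have := H2 s tag abs; rewrite -/S => {}H2.
suff : `|w - v| < `|w - v| by rewrite ltxx.
rewrite {1}(_ : w - v = - (S - w) + (S - v)); last by ring.
rewrite (le_lt_trans (ler_normD _ _))// normrN [ltRHS]splitr ltrD//.
- apply: H2 => k /mesh[tk]; rewrite lt_min => /andP[_ ?]; split => //.
- apply: H1 => k /mesh[tk]; rewrite lt_min => /andP[? _]; split => //.
Qed.

End Stieltjes.

(** * Sine and cosine of the tangent angle *)

Section Cosine.
Context {R : realType}.
Implicit Types u v : R.

(** The cosine of the angle in [0, pi / 2] whose sine is u. Clasp arcs are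
    parametrized by the sine u of the angle between the tangent and the horizontal.
    As a function on R it vanishes outside [-1, 1], which lets shifted copies of it
    be added in tangent_x. *)
Definition cosine u : R := Num.sqrt (1 - u ^+ 2).

Lemma cosine_ge0 u : 0 <= cosine u.
Proof. exact: sqrtr_ge0. Qed.

Lemma cosine0 : cosine 0 = 1.
Proof. by rewrite /cosine expr0n subr0 sqrtr1. Qed.

Lemma cosine1 : cosine 1 = 0.
Proof. by rewrite /cosine expr1n subrr sqrtr0. Qed.

Lemma cosineN u : cosine (- u) = cosine u.
Proof. by rewrite /cosine sqrrN. Qed.

Lemma cosine_out u : 1 <= `|u| -> cosine u = 0.
Proof.
move=> u1; rewrite /cosine ler0_sqrtr// subr_le0 -real_normK ?num_real//.
by rewrite exprn_ege1.
Qed.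

Lemma sqr_cosine u : 0 <= u <= 1 -> cosine u ^+ 2 = 1 - u ^+ 2.
Proof. by move=> u01; rewrite sqr_sqrtr//; nra. Qed.

Lemma cosine_gt0 u : 0 <= u < 1 -> 0 < cosine u.
Proof. by move=> u01; rewrite sqrtr_gt0; nra. Qed.

Lemma cosine_le1 u : cosine u <= 1.
Proof. by rewrite -[leRHS]sqrtr1 ler_wsqrtr// lerBlDr lerDl sqr_ge0. Qed.

Lemma le_cosine u v : 0 <= u -> u <= v -> cosine v <= cosine u.
Proof. by move=> u0 uv; rewrite ler_wsqrtr//; nra. Qed.

Lemma cosineK u : 0 <= u <= 1 -> cosine (cosine u) = u.
Proof.
move=> u01; rewrite {1}/cosine sqr_cosine// opprB addrC subrK sqrtr_sqr.
by rewrite ger0_norm//; lra.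
Qed.

Lemma continuous_cosine : continuous (cosine : R -> R).
Proof.
move=> u; apply: continuous_comp; last exact: sqrt_continuous.
apply: continuousB; first exact: cst_continuous.
exact: exprn_continuous.
Qed.

Lemma is_derive_cosine u : 0 < u < 1 -> is_derive u 1 cosine (- (u / cosine u)).
Proof.
move=> u01.
have c0 : 0 < 1 - u ^+ 2 by nra.
have H := is_derive1_sqrt c0.
have -> : - (u / cosine u) = (2 * Num.sqrt (1 - u ^+ 2))^-1 * (- (u *+ 2)).
  rewrite /cosine invfM mulr2n; field.
  by rewrite gt_eqF// sqrtr_gt0.
apply: is_derive1_comp.
by apply: is_derive_eq; rewrite /GRing.scale/=; ring.
Qed.

End Cosine.

(** * Stieltjes integrals along an arc *)

Section Primitives.
Context {R : realType}.
Implicit Types f g : R -> R.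

Lemma continuous_primitive g : continuous g ->
  exists P : R -> R, forall x : R, 0 <= x <= 1 -> is_derive x 1 P (g x).
Proof.
move=> cg; exists (fun x => \int[@lebesgue_measure R]_(t in [set` `[(-1), x]]) g t).
move=> x x01.
have [] := @continuous_FTC1_closed R g (-1) x 2 _ _ _ _.
- lra.
- apply: continuous_compact_integrable; first exact: segment_compact.
  exact: continuous_subspaceT.
- lra.
- exact: cg.
move=> dP; rewrite derive1E => <-; exact: derivableP.
Qed.

Lemma is_derive_continuous (P : R -> R) (x d : R) :
  is_derive x 1 P d -> {for x, continuous P}.
Proof.
move=> [dP _]; apply: differentiable_continuous; exact/derivable1_diffP.
Qed.

Lemma primitive_mean_value (P g : R -> R) x y :
  (forall x : R, 0 <= x <= 1 -> is_derive x 1 P (g x)) ->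
  0 <= x -> x <= y -> y <= 1 ->
  exists2 t, x <= t <= y & P y - P x = g t * (y - x).
Proof.
move=> dP x0 xy y1.
have [||t] := @MVT_segment R P g x y xy.
- move=> t; rewrite in_itv/= => /andP[xt ty]; apply: dP; lra.
- rewrite continuous_subspace_in => t /set_mem/=; rewrite in_itv/= => /andP[xt ty].
  apply: continuous_subspaceT_for; first by rewrite /= in_itv/= xt.
  apply: is_derive_continuous (dP t _); lra.
- by rewrite in_itv/=; exists t.
Qed.

(** The substitution u = cosine t in the mean value theorem, cosine being its own
    inverse. *)
Lemma cosine_mean_value (P g : R -> R) x y :
  (forall x : R, 0 <= x <= 1 -> is_derive x 1 P (g (cosine x))) ->
  0 <= x -> x <= y -> y <= 1 ->
  exists2 t, x <= t <= y &
    P (cosine y) - P (cosine x) = g t * (cosine y - cosine x).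
Proof.
move=> dP x0 xy y1.
have [t /andP[yt tx] E] := primitive_mean_value dP (cosine_ge0 y)
  (le_cosine x0 xy) (cosine_le1 x).
have t0 := cosine_ge0 t.
exists (cosine t).
  have -> : x = cosine (cosine x) by rewrite cosineK//; lra.
  have -> : y = cosine (cosine y) by rewrite cosineK//; lra.
  by rewrite !le_cosine// ?cosine_ge0// (le_trans (cosine_ge0 y)).
by move: E; rewrite -opprB => /eqP; rewrite eqr_oppLR => /eqP ->; ring.
Qed.

(** Transports a mean value property from the parameter u in [0, 1] to the piece
    of curve parametrized by s = p + q u, run through forwards (q = 1) or backwards
    (q = - 1). Reversing the direction changes the sign of the tangent as well,
    hence the factor q in G, and the value does not depend on q. *)
Lemma has_stieltjes_affine (f H Phi G : R -> R) (lo p q k : R) :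
  (q = 1 /\ lo = p) \/ (q = - 1 /\ lo = p - 1) ->
  (forall x y, 0 <= x -> x <= y -> y <= 1 -> exists2 t, x <= t <= y &
    Phi y - Phi x = f (p + q * t) * (H y - H x)) ->
  (forall s, lo <= s <= lo + 1 -> G s = q * k * H (q * (s - p))) ->
  has_stieltjes lo (lo + 1) f G (k * (Phi 1 - Phi 0)).
Proof.
move=> pq mv hG.
have -> : k * (Phi 1 - Phi 0) =
    q * k * Phi (q * (lo + 1 - p)) - q * k * Phi (q * (lo - p)).
  case: pq => -[-> ->].
    have -> : 1 * (p + 1 - p) = 1 by ring.
    by rewrite subrr mulr0; ring.
  have -> : -1 * (p - 1 - p) = 1 by ring.
  have -> : -1 * (p - 1 + 1 - p) = 0 by ring.
  ring.
apply: (@has_stieltjes_mean_value _ _ _ _ _ (fun s => q * k * Phi (q * (s - p)))).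
move=> x y lx xy yl; rewrite !hG; [|lra|lra].
case: pq lx yl mv {hG} => -[-> ->] lx yl mv.
- have [|||t /andP[xt ty] E] := mv (1 * (x - p)) (1 * (y - p)); [lra|lra|lra|].
  exists (p + 1 * t); first by apply/andP; split; lra.
  by rewrite -!mulrBr E; ring.
- have [|||t /andP[xt ty] E] := mv (-1 * (y - p)) (-1 * (x - p)); [lra|lra|lra|].
  exists (p + -1 * t); first by apply/andP; split; lra.
  rewrite -!mulrBr -[Phi (-1 * (y - p)) - _]opprB E; ring.
Qed.

(** For the arc with tangent q (sigma cosine u, kappa u) at s = p + q u. The
    increment of Q is minus the integral of (f, g) . dT, that is the share of the
    arc in the variation of length along (f, g). *)
Lemma arc_force (f g Gx Gz : R -> R) (lo p q sigma kappa : R) :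
  continuous f -> continuous g ->
  (q = 1 /\ lo = p) \/ (q = - 1 /\ lo = p - 1) ->
  (forall s, lo <= s <= lo + 1 -> Gx s = q * sigma * cosine (q * (s - p))) ->
  (forall s, lo <= s <= lo + 1 -> Gz s = q * kappa * (q * (s - p))) ->
  exists (Q : R -> R) (vx vz : R), [/\ forall u, 0 <= u <= 1 -> {for u, continuous Q},
    forall u : R, 0 < u < 1 -> is_derive u 1 Q
      (sigma * (u / cosine u) * f (p + q * u) - kappa * g (p + q * u)),
    has_stieltjes lo (lo + 1) f Gx vx,
    has_stieltjes lo (lo + 1) g Gz vz
    & vx + vz = - (Q 1 - Q 0)].
Proof.
move=> cf cg pq hGx hGz.
have caff (h : R -> R) : continuous h -> continuous (fun u => h (p + q * u)).
  move=> ch u; apply: (@continuous_comp _ _ _ (fun u => p + q * u) h); last exact: ch.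
  apply: continuousD; first exact: cst_continuous.
  apply: continuousM; first exact: cst_continuous.
  exact: cvg_id.
have [|P dP] := @continuous_primitive (fun x => f (p + q * cosine x)).
  move=> u; apply: (@continuous_comp _ _ _ cosine (fun u => f (p + q * u))).
    exact: continuous_cosine.
  exact: caff.
have [S dS] := continuous_primitive (caff _ cg).
have cosine01 (u : R) : 0 <= cosine u <= 1 by rewrite cosine_ge0 cosine_le1.
exists (fun u => - sigma * P (cosine u) - kappa * S u),
  (sigma * (P 0 - P 1)), (kappa * (S 1 - S 0)); split.
- move=> u u01; apply: continuousB.
    apply: continuousM; first exact: cst_continuous.
    apply: (@continuous_comp _ _ _ cosine P); first exact: continuous_cosine.
    exact: is_derive_continuous (dP _ (cosine01 u)).
  apply: continuousM; first exact: cst_continuous.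
  exact: is_derive_continuous (dS u u01).
- move=> u u01.
  have dc := is_derive_cosine u01.
  have dPc := is_derive1_comp (dP _ (cosine01 u)) dc.
  have u01' : 0 <= u <= 1 by lra.
  have dSu := dS _ u01'.
  rewrite (cosineK u01') in dPc.
  have -> : sigma * (u / cosine u) * f (p + q * u) - kappa * g (p + q * u) =
    - sigma *: (f (p + q * u) * - (u / cosine u)) - kappa *: g (p + q * u).
    rewrite /GRing.scale/=; ring.
  exact: is_deriveB.
- have -> : P 0 - P 1 = (P \o cosine) 1 - (P \o cosine) 0 by rewrite /= cosine0 cosine1.
  apply: (has_stieltjes_affine (H := cosine) (Phi := P \o cosine) pq) => //.
  move=> x y x0 xy y1.
  apply: (@cosine_mean_value P (fun u => f (p + q * u))) => //.
- by apply: (has_stieltjes_affine (H := id) pq) => // x y; exact: primitive_mean_value.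
- rewrite /= cosine0 cosine1; ring.
Qed.

End Primitives.

(** * The horizontal coordinate of a clasp arc *)

Section ClaspX.
Context {R : realType}.
Implicit Types u : R.
Local Notation X := (clasp_X (R := R)).

Lemma clasp_X0 : X 0 = 0.
Proof. by rewrite /clasp_X expr0n !mul0r sqrtr0. Qed.

Lemma clasp_X1 : X 1 = 1.
Proof.
rewrite /clasp_X subrr expr0n/= mulr0 subr0 expr1n mulr1 divr1.
by rewrite sqrtr1.
Qed.

Lemma clasp_X_ge0 u : 0 <= X u.
Proof. exact: sqrtr_ge0. Qed.

Lemma onem_mul_itv u : 0 <= u <= 1 -> 0 <= u * (1 - u) <= 1 / 4.
Proof.
move=> /andP[u0 u1]; rewrite mulr_ge0 ?subr_ge0//=.
by have := sqr_ge0 (u - 1 / 2); rewrite expr2; lra.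
Qed.

Lemma clasp_denom_ge u : 0 <= u <= 1 -> 15 / 16 <= 1 - u ^+ 2 * (1 - u) ^+ 2.
Proof. by move=> /onem_mul_itv; rewrite -exprMn; set t := u * _ => ?; nra. Qed.

Lemma clasp_denom_gt0 u : 0 <= u <= 1 -> 0 < 1 - u ^+ 2 * (1 - u) ^+ 2.
Proof. by move=> /clasp_denom_ge; lra. Qed.

Lemma clasp_X_sqr u : 0 <= u <= 1 ->
  X u ^+ 2 = u ^+ 2 * (1 - (1 - u) ^+ 2) / (1 - u ^+ 2 * (1 - u) ^+ 2).
Proof.
move=> u01; rewrite sqr_sqrtr// divr_ge0 ?(ltW (clasp_denom_gt0 u01))//.
by rewrite mulr_ge0 ?sqr_ge0//; nra.
Qed.

Lemma clasp_X_gt0 u : 0 < u <= 1 -> 0 < X u.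
Proof.
move=> u01; rewrite sqrtr_gt0 divr_gt0//; last by apply: clasp_denom_gt0; lra.
by rewrite mulr_gt0//; nra.
Qed.

Lemma clasp_X_le u : 0 <= u <= 1 -> X u <= u.
Proof.
move=> u01; have d0 := clasp_denom_gt0 u01.
rewrite -(ler_pXn2r (n := 2))// ?nnegrE ?clasp_X_ge0//; last by lra.
rewrite clasp_X_sqr// ler_pdivrMr// ler_wpM2l ?sqr_ge0// lerD2l lerN2.
by rewrite ler_piMl ?sqr_ge0//; nra.
Qed.

Lemma clasp_X_le1 u : 0 <= u <= 1 -> X u <= 1.
Proof. by move=> /[dup] u01 /clasp_X_le; lra. Qed.

(** The logarithmic derivative of X^2. *)
Definition clasp_logderiv u : R :=
  3 / u - 1 / (2 - u) +
  2 * u * (1 - u) * (1 - 2 * u) / (1 - u ^+ 2 * (1 - u) ^+ 2).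

(** The last two terms are at most 1 and 8 / 15 in absolute value, and the term
    3 / u >= 3 dominates them. *)
Lemma clasp_logderiv_itv u : 0 < u < 1 -> 0 < clasp_logderiv u <= 4 / u.
Proof.
move=> u01; rewrite /clasp_logderiv.
have ? : 0 <= u <= 1 by lra.
have d0 := @clasp_denom_gt0 u ltac:(lra).
have d1 := @clasp_denom_ge u ltac:(lra).
have uV : 1 <= u^-1 by rewrite invf_ge1//; lra.
have vV : 1 / 2 <= 1 / (2 - u) <= 1.
  by rewrite ler_pdivlMr ?ler_pdivrMr; lra.
have : - (8 / 15) <= 2 * u * (1 - u) * (1 - 2 * u) / (1 - u ^+ 2 * (1 - u) ^+ 2)
    <= 8 / 15.
  have := @onem_mul_itv u ltac:(lra); set t := u * (1 - u) => tb.
  have -> : 2 * u * (1 - u) * (1 - 2 * u) = 2 * t * (1 - 2 * u).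
    by rewrite /t; ring.
  by rewrite ler_pdivlMr// ler_pdivrMr//; apply/andP; split; nra.
move: (_ / (1 - _)) => w; lra.
Qed.

Lemma is_derive_clasp_X u : 0 < u < 1 ->
  is_derive u 1 X (X u * clasp_logderiv u / 2).
Proof.
move=> u01; have u01' : 0 <= u <= 1 by lra.
have d0 := clasp_denom_gt0 u01'.
have dN : is_derive u 1 (fun u : R => u ^+ 2 * (1 - (1 - u) ^+ 2))
    (6 * u ^+ 2 - 4 * u ^+ 3).
  by apply: is_derive_eq; rewrite /GRing.scale/=; ring.
have dQ : is_derive u 1 (fun u : R => 1 - u ^+ 2 * (1 - u) ^+ 2)
    (- 2 * u * (1 - u) * (1 - 2 * u)).
  by apply: is_derive_eq; rewrite /GRing.scale/=; ring.
have dQV := is_deriveV (f := fun u : R => 1 - u ^+ 2 * (1 - u) ^+ 2)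
  (lt0r_neq0 d0) dQ.
pose r (x : R) := x ^+ 2 * (1 - (1 - x) ^+ 2) / (1 - x ^+ 2 * (1 - x) ^+ 2).
have dr : is_derive u 1 r _ := is_deriveM dN dQV.
have X0 : 0 < X u by apply: clasp_X_gt0; lra.
have r0 : 0 < r u by move: X0; rewrite sqrtr_gt0.
have := is_derive1_comp (f := Num.sqrt) (g := r) (is_derive1_sqrt r0) dr.
congr (is_derive _ _ _ _).
rewrite -/(clasp_X u).
rewrite /GRing.scale/= [X in X * _ = _](_ : _ = (2 * X u)^-1)//.
have X2 := clasp_X_sqr u01'.
apply: (mulfI (x := 2 * X u)); first by rewrite gt_eqF// mulr_gt0.
rewrite mulrA mulfV ?gt_eqF ?mulr_gt0// mul1r.
transitivity (X u ^+ 2 * clasp_logderiv u); last by field.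
rewrite X2 /clasp_logderiv; field.
by rewrite !gt_eqF//; lra.
Qed.

End ClaspX.

(** * The height of a clasp arc *)

Section ClaspZ.
Context {R : realType}.
Implicit Types u s : R.
Local Notation X := (clasp_X (R := R)).
Local Notation Z := (clasp_Z (R := R)).
Local Notation mu := (@lebesgue_measure R).

(** The slope of the tangent of a clasp arc, d Z / d X. *)
Definition slope u : R := u / cosine u.

Lemma slope_ge0 u : 0 <= u -> 0 <= slope u.
Proof. by move=> u0; rewrite divr_ge0// cosine_ge0. Qed.

Lemma continuous_slope u : 0 <= u < 1 -> {for u, continuous slope}.
Proof.
move=> u01; apply: continuousM; first exact: cvg_id.
apply: continuousV; first by rewrite gt_eqF// cosine_gt0.
exact: continuous_cosine.
Qed.

Lemma measurable_slope : measurable_fun (`[0, 1] : set R) slope.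
Proof.
apply: (@measurable_fun_itv_cc _ _ _ false true).
apply: open_continuous_measurable_fun; first exact: interval_open.
move=> u; rewrite inE/= in_itv/= => u01; apply: continuous_slope; lra.
Qed.

(** The primitive - cosine of slope is continuous up to 1, where slope blows up. *)
Lemma integral_slope_le1 n :
  (\int[mu]_(s in `[0%R, (1 - n.+1%:R^-1)%R]) (slope s)%:E <= 1)%E.
Proof.
case: n => [|n].
  by rewrite invr1 subrr set_itv1 integral_set1 lee01.
have n0 : 0 < n.+2%:R^-1 :> R by rewrite invr_gt0.
have n1 : n.+2%:R^-1 < 1 :> R by rewrite invf_lt1// ltr1n.
move: n0 n1; set d := _^-1 => d0 d1.
rewrite (@continuous_FTC2 _ _ (fun s => - cosine s)).
- by rewrite cosine0 -EFinB lee_fin opprK addrC gerBl cosine_ge0.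
- by rewrite subr_gt0.
- rewrite continuous_subspace_in => u /set_mem/=; rewrite in_itv/= => u01.
  apply: continuous_subspaceT_for; first by rewrite /= in_itv.
  by apply: continuous_slope; lra.
- split.
  + move=> u; rewrite in_itv/= => u01; apply: derivableN.
    by have [] := @is_derive_cosine R u ltac:(lra).
  + by apply: cvg_at_right_filter; apply: continuousN; exact: continuous_cosine.
  + by apply: cvg_at_left_filter; apply: continuousN; exact: continuous_cosine.
- move=> u; rewrite in_itv/= => u01.
  have dc := @is_derive_cosine R u ltac:(lra).
  by rewrite derive1E (@derive_val _ _ _ _ _ _ _ (is_deriveN dc)) opprK.
Qed.

Lemma integrable_slope : mu.-integrable `[0, 1] (EFin \o slope).
Proof.
have mS := measurable_slope.
apply/integrableP; split; first exact/measurable_EFinP.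
have -> : (\int[mu]_(x in `[0%R, 1%R]) `|(EFin \o slope) x| =
           \int[mu]_(x in `[0%R, 1%R[) (slope x)%:E)%E.
  rewrite integral_itv_bndo_bndc; last first.
    apply/measurable_EFinP; apply: measurable_funS mS => //.
    by apply: subset_itvl; rewrite bnd_simp.
  apply: eq_integral => x; rewrite inE/= in_itv/= => /andP[x0 _].
  by rewrite ger0_norm// slope_ge0.
apply: (@le_lt_trans _ _ 1%E); last exact: ltry.
rewrite itv_bnd_open_bigcup.
have sub (n : nat) : `[0, 1 - n.+1%:R^-1] `<=` (`[0, 1] : set R).
  by apply: subset_itvl; rewrite bnd_simp gerBl.
have := @ge0_nondecreasing_set_cvg_integral _ _ R
  (fun n : nat => `[0, 1 - n.+1%:R^-1]%classic : set (measurableTypeR R))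
  (EFin \o slope) mu.
move=> cv; apply: (cvge_le _ (cv _ _ _ _)) => //.
- by near=> n; exact: integral_slope_le1.
- move=> n m nm; apply/subsetPset; apply: subset_itvl.
  by rewrite bnd_simp lerD2l lerN2 lef_pV2 ?posrE// ler_nat.
- by move=> n; apply/measurable_EFinP; exact: measurable_funS (sub n) mS.
- by move=> n x /=; rewrite in_itv/= => /andP[x0 _]; rewrite lee_fin slope_ge0.
Unshelve. all: by end_near. Qed.

Definition clasp_dX u : R := X u * clasp_logderiv u / 2.

(** Upper bound: X u <= u and the logarithmic derivative is at most 4 / u. It
    makes Z' = slope X' at most 2 slope, hence integrable. *)
Lemma clasp_dX_itv u : 0 < u < 1 -> 0 < clasp_dX u <= 2.
Proof.
move=> u01; have u01' : 0 < u <= 1 by lra.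
have /andP[l0 l4] := clasp_logderiv_itv u01.
have X0 := clasp_X_gt0 u01'.
have Xu : X u <= u by apply: clasp_X_le; lra.
rewrite /clasp_dX divr_gt0 ?mulr_gt0//= ler_pdivrMr//.
rewrite (le_trans (ler_pM (ltW X0) (ltW l0) Xu l4))//.
by rewrite mulrC divfK ?gt_eqF//; lra.
Qed.

Lemma clasp_X_derive1 u : 0 < u < 1 -> (X^`())%classic u = clasp_dX u.
Proof.
move=> u01; rewrite derive1E.
exact: (@derive_val _ _ _ _ _ _ _ (is_derive_clasp_X u01)).
Qed.

Lemma continuous_clasp_logderiv u : 0 < u < 1 -> {for u, continuous clasp_logderiv}.
Proof.
move=> u01; have d0 := @clasp_denom_gt0 R u ltac:(lra).
have cid : {for u, continuous (fun x : R => x)} by exact: cvg_id.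
have cc (k : R) : {for u, continuous (fun _ : R => k)} by exact: cst_continuous.
have cB (k : R) : {for u, continuous (fun x : R => k - x)} by exact: continuousB.
apply: continuousD; first apply: continuousB.
- by apply: continuousM => //; apply: continuousV => //; rewrite gt_eqF//; lra.
- by apply: continuousM => //; apply: continuousV => //; rewrite gt_eqF//; lra.
- apply: continuousM.
    apply: continuousM; first by do 2 apply: continuousM => //.
    by apply: continuousB => //; apply: continuousM.
  apply: continuousV; first by rewrite gt_eqF.
  apply: continuousB => //; apply: continuousM; first exact: exprn_continuous.
  apply: (@continuous_comp _ _ _ (fun x : R => 1 - x) (fun x => x ^+ 2)) => //.
  exact: exprn_continuous.
Qed.

Lemma continuous_clasp_dX u : 0 < u < 1 -> {for u, continuous clasp_dX}.
Proof.
move=> u01; apply: continuousM; last exact: cst_continuous.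
apply: continuousM; last exact: continuous_clasp_logderiv.
exact: is_derive_continuous (is_derive_clasp_X u01).
Qed.

Let dZ s : R := s / Num.sqrt (1 - s ^+ 2) * (X^`())%classic s.

Lemma clasp_dZE s : 0 < s < 1 -> dZ s = slope s * clasp_dX s.
Proof. by move=> s01; rewrite /dZ clasp_X_derive1. Qed.

Lemma continuous_clasp_dZ s : 0 < s < 1 -> {for s, continuous dZ}.
Proof.
move=> s01; rewrite /prop_for /continuous_at clasp_dZE//.
apply: (@cvg_trans _ (slope x * clasp_dX x @[x --> s])); last first.
  apply: continuousM; first by apply: continuous_slope; lra.
  exact: continuous_clasp_dX.
apply: near_eq_cvg; near=> x; rewrite clasp_dZE//.
suff : x \in `]0, 1[ by rewrite in_itv.
near: x; apply: near_in_itvoo; by rewrite in_itv.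
Unshelve. all: by end_near. Qed.

(** Domination by 2 slope. At the ends 0 and 1 the integrand is 0, by the
    convention on division by zero at 1. *)
Lemma integrable_clasp_dZ : mu.-integrable `[0, 1] (EFin \o dZ).
Proof.
have iS : mu.-integrable `[0, 1] (EFin \o (fun s => 2 * slope s)).
  exact: (integrableZl _ 2 integrable_slope).
apply: (le_integrable _ _ _ iS) => //.
- apply/measurable_EFinP; apply: (@measurable_fun_itv_cc _ _ _ false true).
  apply: open_continuous_measurable_fun; first exact: interval_open.
  by move=> u; rewrite inE/= in_itv/= => u01; exact: continuous_clasp_dZ.
- move=> s /=; rewrite in_itv/= => /andP[s0 s1]; rewrite lee_fin.
  have [->|s0'] := eqVneq s 0; first by rewrite /dZ !mul0r normr0.
  have [->|s1'] := eqVneq s 1.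
    by rewrite /dZ expr1n subrr sqrtr0 invr0 mulr0 mul0r normr0.
  have s01 : 0 < s < 1 by rewrite !lt_neqAle s0 s1 s1' eq_sym s0'.
  have /andP[d0 d2] := clasp_dX_itv s01.
  have p0 := mulr_ge0 (slope_ge0 s0) (ltW d0).
  have q0 : 0 <= 2 * slope s by rewrite mulr_ge0// slope_ge0.
  rewrite clasp_dZE// (ger0_norm p0) (ger0_norm q0).
  by rewrite mulrC ler_wpM2r ?slope_ge0.
Qed.

Lemma clasp_Z0 : Z 0 = 0.
Proof. by rewrite /clasp_Z set_itv1 Rintegral_set1. Qed.

Lemma continuous_clasp_Z : {within `[0, 1], continuous Z}.
Proof. exact: (parameterized_integral_continuous ler01 integrable_clasp_dZ). Qed.

Lemma is_derive_clasp_Z u : 0 < u < 1 -> is_derive u 1 Z (slope u * clasp_dX u).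
Proof.
move=> u01.
have [||||dP dE] := @continuous_FTC1_closed R dZ 0 u 1.
- lra.
- exact: integrable_clasp_dZ.
- lra.
- exact: continuous_clasp_dZ.
rewrite -(clasp_dZE u01); apply: DeriveDef dP _; rewrite -derive1E; exact: dE.
Qed.

End ClaspZ.

(** * Monotonicity from derivatives *)

Section Clip.
Context {R : realType}.
Implicit Types a b x : R.

Definition clip a b x : R := Num.max a (Num.min b x).

Lemma clip_itv a b x : a <= b -> a <= clip a b x <= b.
Proof. by move=> ab; rewrite /clip le_max lexx ge_max ab ge_min lexx. Qed.

Lemma clip_id a b x : a <= x <= b -> clip a b x = x.
Proof. by move=> /andP[ax xb]; rewrite /clip min_r// max_r. Qed.

Lemma continuous_clip a b : continuous (clip a b).
Proof.
apply: max_fun_continuous; first exact: cst_continuous.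
apply: min_fun_continuous; first exact: cst_continuous.
by move=> x; exact: cvg_id.
Qed.

(** Replaces a function continuous on a segment by one that is continuous on the
    whole line and agrees with it on the segment. *)
Lemma continuous_comp_clip (T : topologicalType) (f : R -> T) a b : a <= b ->
  {within `[a, b], continuous f} -> continuous (f \o clip a b).
Proof.
move=> ab /subspace_continuousP cf x.
have cx : `[a, b]%classic (clip a b x) by rewrite /= in_itv/= clip_itv.
move=> U /(cf _ cx) UA.
have := @continuous_clip a b x _ UA.
apply: (@filterS _ (nbhs x)) => y /= Uy; apply: Uy.
by rewrite in_itv/= clip_itv.
Qed.

Lemma derive_mean (f df : R -> R) a b : a < b ->
  (forall x : R, a < x < b -> is_derive x 1 f (df x)) ->
  (forall x, a <= x <= b -> {for x, continuous f}) ->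
  exists2 c, a < c < b & f b - f a = df c * (b - a).
Proof.
move=> ab dfx cf.
have [|c] := @MVT R f df a b ab dfx; last by rewrite in_itv; exists c.
rewrite continuous_subspace_in => x /set_mem/=; rewrite in_itv/= => xab.
apply: continuous_subspaceT_for; first by rewrite /= in_itv.
exact: cf.
Qed.

Lemma derive_ge0_le (f df : R -> R) a b : a <= b ->
  (forall x : R, a < x < b -> is_derive x 1 f (df x)) ->
  (forall x, a <= x <= b -> {for x, continuous f}) ->
  (forall x, a < x < b -> 0 <= df x) -> f a <= f b.
Proof.
rewrite le_eqVlt => /predU1P[->//|ab] dfx cf df0.
have [c cab E] := derive_mean ab dfx cf.
by rewrite -subr_ge0 E mulr_ge0 ?df0// subr_ge0 ltW.
Qed.

Lemma is_derive_clip (f : R -> R) a b x d : a < x < b ->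
  is_derive x 1 f d -> is_derive x 1 (f \o clip a b) d.
Proof.
move=> xab; apply: near_eq_is_derive.
near=> y; rewrite /= clip_id//.
suff : y \in `]a, b[ by rewrite in_itv/= => /andP[ay yb]; rewrite !ltW.
by near: y; apply: near_in_itvoo; rewrite in_itv.
Unshelve. all: by end_near. Qed.

End Clip.

(** * The gap between facing arcs *)

Section ClaspGeometry.
Context {R : realType}.
Implicit Types u w t : R.
Local Notation X := (clasp_X (R := R)).
Local Notation h := (clasp_h R).
Let Z : R -> R := clasp_Z (R := R) \o clip 0 1.

Let ZE u : 0 <= u <= 1 -> Z u = clasp_Z u.
Proof. by move=> u01; rewrite /Z/= clip_id. Qed.

Let cZ : continuous Z.
Proof. exact: continuous_comp_clip ler01 continuous_clasp_Z. Qed.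

Let dZ u : 0 < u < 1 -> is_derive u 1 Z (slope u * clasp_dX u).
Proof. by move=> u01; apply: is_derive_clip => //; exact: is_derive_clasp_Z. Qed.

Lemma continuous_clasp_X u : 0 <= u <= 1 -> {for u, continuous X}.
Proof.
move=> u01; have d0 := clasp_denom_gt0 u01.
have cc (k : R) : {for u, continuous (fun _ : R => k)} by exact: cst_continuous.
have cid : {for u, continuous (fun x : R => x)} by exact: cvg_id.
have cv2 : {for u, continuous (fun x : R => (1 - x) ^+ 2)}.
  apply: (@continuous_comp _ _ _ (fun x : R => 1 - x) (fun x => x ^+ 2)).
    exact: continuousB.
  exact: exprn_continuous.
apply: (@continuous_comp _ _ _ (fun u : R => u ^+ 2 * (1 - (1 - u) ^+ 2)
  / (1 - u ^+ 2 * (1 - u) ^+ 2))); last exact: sqrt_continuous.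
apply: continuousM.
  by apply: continuousM; [exact: exprn_continuous|exact: continuousB].
apply: continuousV; first by rewrite gt_eqF.
by apply: continuousB => //; apply: continuousM => //; exact: exprn_continuous.
Qed.

(** The height that two points at the parameters u and 1 - u of orthogonal arcs
    need in order to be at distance 1. *)
Definition clasp_gap u : R := Num.sqrt (1 - X u ^+ 2 - X (1 - u) ^+ 2).

Lemma clasp_gap_sqr u : 0 <= u <= 1 ->
  1 - X u ^+ 2 - X (1 - u) ^+ 2 =
  (1 - u ^+ 2) * (1 - (1 - u) ^+ 2) / (1 - u ^+ 2 * (1 - u) ^+ 2).
Proof.
move=> u01; have d0 := clasp_denom_gt0 u01.
rewrite !clasp_X_sqr//; last by lra.
rewrite subKr; field.
by rewrite exprMn gt_eqF.
Qed.

Lemma clasp_gap_gt0 u : 0 < u < 1 -> 0 < clasp_gap u.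
Proof.
move=> u01; rewrite sqrtr_gt0 clasp_gap_sqr; last by lra.
rewrite divr_gt0//; last by apply: clasp_denom_gt0; lra.
by rewrite mulr_gt0//; nra.
Qed.

Lemma sqr_clasp_gap u : 0 <= u <= 1 ->
  clasp_gap u ^+ 2 = 1 - X u ^+ 2 - X (1 - u) ^+ 2.
Proof.
move=> u01; rewrite sqr_sqrtr// clasp_gap_sqr//.
rewrite divr_ge0 ?(ltW (clasp_denom_gt0 u01))//.
by rewrite mulr_ge0//; nra.
Qed.

Lemma clasp_gap_onem u : clasp_gap (1 - u) = clasp_gap u.
Proof. by rewrite /clasp_gap subKr addrAC. Qed.

(** Both sides have the square
    u^2 (1 - (1 - u)^2) / (1 - u^2 (1 - u)^2). Geometrically, the sum of the two
    struts at the point u is proportional to (slope u, 1), the direction of the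
    curvature of the arc: this is the balance of forces on the arc. *)
Lemma clasp_gap_slope u : 0 <= u < 1 -> X u = slope u * clasp_gap u.
Proof.
move=> u01; have u01' : 0 <= u <= 1 by lra.
have c0 := cosine_gt0 u01; have d0 := clasp_denom_gt0 u01'.
apply/eqP; rewrite -(eqrXn2 (n := 2))//; first last.
- by rewrite mulr_ge0 ?slope_ge0 ?sqrtr_ge0//; lra.
- exact: clasp_X_ge0.
apply/eqP; rewrite exprMn sqr_clasp_gap// clasp_gap_sqr// clasp_X_sqr//.
rewrite /slope expr_div_n sqr_cosine//; field.
by rewrite !gt_eqF//; nra.
Qed.

(** Differentiating clasp_gap^2 = 1 - X(u)^2 - X(1 - u)^2 and dividing by
    clasp_gap turns the factors X into slopes, by clasp_gap_slope. *)
Lemma is_derive_clasp_gap u : 0 < u < 1 -> is_derive u 1 clasp_gap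
  (slope (1 - u) * clasp_dX (1 - u) - slope u * clasp_dX u).
Proof.
move=> u01; have v01 : 0 < 1 - u < 1 by lra.
have g0 := clasp_gap_gt0 u01.
have dX := is_derive_clasp_X u01; have dX' := is_derive_clasp_X v01.
have dv : is_derive u 1 (fun x : R => 1 - x) (-1).
  by apply: is_derive_eq; ring.
have dXv := is_derive1_comp (f := X) (g := fun x : R => 1 - x) dX' dv.
have dr : is_derive u 1 (fun u => 1 - X u ^+ 2 - X (1 - u) ^+ 2)
    (- 2 * X u * clasp_dX u + 2 * X (1 - u) * clasp_dX (1 - u)).
  have dXv' : is_derive u 1 (fun x => X (1 - x)) _ := dXv.
  by apply: is_derive_eq; rewrite /GRing.scale/= /clasp_dX; ring.
have r0 : 0 < 1 - X u ^+ 2 - X (1 - u) ^+ 2 by move: g0; rewrite sqrtr_gt0.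
have := is_derive1_comp (f := Num.sqrt)
  (g := fun u => 1 - X u ^+ 2 - X (1 - u) ^+ 2) (is_derive1_sqrt r0) dr.
congr (is_derive _ _ _ _).
rewrite -/(clasp_gap u).
rewrite {1}(@clasp_gap_slope u) ?{1}(@clasp_gap_slope (1 - u)); [|lra|lra].
rewrite clasp_gap_onem; field.
by rewrite gt_eqF.
Qed.

(** By is_derive_clasp_gap, clasp_gap u + Z u + Z (1 - u) has derivative 0; it
    is h at 0. *)
Lemma clasp_gapE u : 0 <= u <= 1 -> clasp_gap u = h - clasp_Z u - clasp_Z (1 - u).
Proof.
move=> u01.
pose F t := clasp_gap t + Z t + Z (1 - t).
have F0 : F 0 = h.
  rewrite /F /clasp_gap clasp_X0 subr0 clasp_X1 expr0n expr1n subr0 subrr sqrtr0.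
  by rewrite !ZE ?ler01 ?lexx// clasp_Z0 !add0r.
suff : F u = F 0.
  by rewrite F0 /F !ZE//; [move=> <-; ring|lra].
have [->//|u0] := eqVneq u 0.
have u0' : 0 < u by rewrite lt_neqAle eq_sym u0; lra.
have cF x : 0 <= x <= u -> {for x, continuous F}.
  move=> xu.
  have cv : {for x, continuous (fun x : R => 1 - x)}.
    by apply: continuousB; [exact: cst_continuous|exact: cvg_id].
  apply: continuousD; first apply: continuousD.
  - apply: (@continuous_comp _ _ _ (fun u => 1 - X u ^+ 2 - X (1 - u) ^+ 2));
      last exact: sqrt_continuous.
    apply: continuousB; first apply: continuousB; first exact: cst_continuous.
    + apply: (@continuous_comp _ _ _ X (fun x => x ^+ 2)).
        by apply: continuous_clasp_X; lra.
      exact: exprn_continuous.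
    + apply: (@continuous_comp _ _ _ (fun u => X (1 - u)) (fun x => x ^+ 2)).
        apply: (@continuous_comp _ _ _ (fun u => 1 - u) X) => //.
        by apply: continuous_clasp_X; lra.
      exact: exprn_continuous.
  - exact: cZ.
  - by apply: (@continuous_comp _ _ _ (fun u => 1 - u) Z) => //; exact: cZ.
have [|c cu E] := @derive_mean _ F (fun=> 0) 0 u u0' _ cF; last first.
  by apply/eqP; rewrite -subr_eq0 E mul0r.
move=> x xu; have x01 : 0 < x < 1 by lra.
have v01 : 0 < 1 - x < 1 by lra.
have dv : is_derive x 1 (fun x : R => 1 - x) (-1).
  by apply: is_derive_eq; ring.
have dZv := is_derive1_comp (f := Z) (g := fun x : R => 1 - x) (dZ v01) dv.
have d3 := is_deriveD (is_deriveD (is_derive_clasp_gap x01) (dZ x01)) dZv.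
apply: (@eq_ind _ _ (fun d => is_derive x 1 _ d) d3).
by ring.
Qed.

End ClaspGeometry.

(** * Distances and secants of clasp arcs *)

Section ClaspDistance.
Context {R : realType}.
Implicit Types u w t : R.
Local Notation X := (clasp_X (R := R)).
Local Notation Z := (clasp_Z (R := R)).
Local Notation h := (clasp_h R).

(** The combinations with constant k and l are the ones from which monotonicity and
    the bounds on secants follow: the sign of the derivative is that of k - l slope. *)
Lemma clasp_mean (k l : R) u w : 0 <= u -> u < w -> w <= 1 ->
  exists2 t, u < t < w &
    (k * X w - l * Z w) - (k * X u - l * Z u) =
    clasp_dX t * (k - l * slope t) * (w - u).
Proof.
move=> u0 uw w1; pose F t := k * X t - l * (Z \o clip 0 1) t.
have FE t : 0 <= t <= 1 -> F t = k * X t - l * Z t.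
  by move=> t01; rewrite /F/= clip_id.
rewrite -!FE; [|lra|lra].
apply: (derive_mean uw) => t tuw.
- have t01 : 0 < t < 1 by lra.
  have d1 := is_derive_clip t01 (is_derive_clasp_Z t01).
  have d2 := is_derive_clasp_X t01.
  have := is_deriveB (is_deriveZ k d2) (is_deriveZ l d1).
  congr (is_derive _ _ _ _).
  by rewrite /GRing.scale/= /clasp_dX; ring.
- apply: continuousB; apply: continuousM; try exact: cst_continuous.
    by apply: continuous_clasp_X; lra.
  exact: (continuous_comp_clip ler01 continuous_clasp_Z).
Qed.

Lemma lt_clasp_X u w : 0 <= u -> u < w -> w <= 1 -> X u < X w.
Proof.
move=> u0 uw w1; have [t tuw] := clasp_mean 1 0 u0 uw w1.
have /andP[d0 _] := @clasp_dX_itv R t ltac:(lra).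
rewrite !mul1r !mul0r !subr0 mulr1 -subr_gt0 => ->.
by rewrite mulr_gt0// subr_gt0.
Qed.

Lemma le_clasp_Z u w : 0 <= u -> u <= w -> w <= 1 -> Z u <= Z w.
Proof.
move=> u0 + w1; rewrite le_eqVlt => /predU1P[->//|uw].
have [t tuw] := clasp_mean 0 (-1) u0 uw w1.
have /andP[d0 _] := @clasp_dX_itv R t ltac:(lra).
have s0 := @slope_ge0 R t ltac:(lra).
rewrite !mul0r !sub0r !mulN1r !opprK -subr_ge0 => ->.
by apply: mulr_ge0; [exact: mulr_ge0 (ltW d0) s0|lra].
Qed.

Lemma clasp_Z_itv u : 0 <= u <= 1 -> 0 <= Z u <= h.
Proof.
move=> /andP[u0 u1]; rewrite le_clasp_Z// andbT.
by rewrite -clasp_Z0 le_clasp_Z.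
Qed.

(** As a function of w the right-hand side has derivative
    2 X' slope (Z u - Z (1 - w)), so it decreases up to w = 1 - u and increases
    afterwards; its minimum is 1 by clasp_gapE. *)
Lemma clasp_dist u w : 0 <= u <= 1 -> 0 <= w <= 1 ->
  1 <= X u ^+ 2 + X w ^+ 2 + (h - Z u - Z w) ^+ 2.
Proof.
move=> u01 w01.
have v01 : 0 <= 1 - u <= 1 by lra.
pose F t := X t ^+ 2 + (h - Z u - (Z \o clip 0 1) t) ^+ 2.
have FE t : 0 <= t <= 1 -> F t = X t ^+ 2 + (h - Z u - Z t) ^+ 2.
  by move=> t01; rewrite /F/= clip_id.
have cF t : 0 <= t <= 1 -> {for t, continuous F}.
  move=> t01; apply: continuousD.
    apply: (@continuous_comp _ _ _ X (fun x => x ^+ 2)).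
      exact: continuous_clasp_X.
    exact: exprn_continuous.
  apply: (@continuous_comp _ _ _ (fun t => h - Z u - (Z \o clip 0 1) t)
    (fun x => x ^+ 2)); last exact: exprn_continuous.
  apply: continuousB; first exact: cst_continuous.
  exact: (continuous_comp_clip ler01 continuous_clasp_Z).
pose dF t := 2 * (clasp_dX t * slope t) * (Z u - Z (1 - t)).
have dFE t : 0 < t < 1 -> is_derive t 1 F (dF t).
  move=> t01; have t01' : 0 <= t <= 1 by lra.
  have d1 : is_derive t 1 (fun t => (Z \o clip 0 1) t) _ :=
    is_derive_clip t01 (is_derive_clasp_Z t01).
  have d2 := is_derive_clasp_X t01.
  apply: is_derive_eq; rewrite /GRing.scale/= clip_id// -/(clasp_dX t).
  have := clasp_gapE t01'; have := @clasp_gap_slope R t ltac:(lra).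
  move=> -> ->; rewrite /dF; ring.
have min : F (1 - u) <= F w.
  have [uw|/ltW wu] := leP (1 - u) w.
  - apply: (derive_ge0_le uw (df := dF)) => t tuw.
    + by apply: dFE; lra.
    + by apply: cF; lra.
    + have /andP[d0 _] := @clasp_dX_itv R t ltac:(lra).
      have s0 := @slope_ge0 R t ltac:(lra).
      apply: mulr_ge0; first by rewrite mulr_ge0// (mulr_ge0 (ltW d0) s0).
      by rewrite subr_ge0 le_clasp_Z//; lra.
  - rewrite -lerN2.
    apply: (derive_ge0_le wu (f := fun t => - F t) (df := fun t => - dF t)) => t tuw.
    + by apply: is_deriveN; apply: dFE; lra.
    + by apply: continuousN; apply: cF; lra.
    + have /andP[d0 _] := @clasp_dX_itv R t ltac:(lra).
      have s0 := @slope_ge0 R t ltac:(lra).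
      rewrite -mulrN; apply: mulr_ge0.
        by rewrite mulr_ge0// (mulr_ge0 (ltW d0) s0).
      by rewrite opprB subr_ge0 le_clasp_Z//; lra.
rewrite -addrA -FE//; apply: le_trans (lerD (lexx _) min).
by rewrite FE// -clasp_gapE// sqr_clasp_gap//; lra.
Qed.

(** A vector (x, z) of the first quadrant that is at least as steep as the unit
    vector (b, a) has, once normalized, a larger second and a smaller first
    coordinate. *)
Lemma unit_coords_le (a b x z : R) : 0 <= a -> 0 <= b -> a ^+ 2 + b ^+ 2 = 1 ->
  0 <= x -> 0 <= z -> a * x <= b * z ->
  a * Num.sqrt (x ^+ 2 + z ^+ 2) <= z /\ x <= b * Num.sqrt (x ^+ 2 + z ^+ 2).
Proof.
move=> a0 b0 ab x0 z0 le_.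
have s0 : 0 <= x ^+ 2 + z ^+ 2 by rewrite addr_ge0 ?sqr_ge0.
have sq : (a * x) ^+ 2 <= (b * z) ^+ 2 by rewrite lerXn2r// nnegrE mulr_ge0.
rewrite !exprMn in sq.
split.
- rewrite -(ler_pXn2r (n := 2))// ?nnegrE ?mulr_ge0 ?sqrtr_ge0//.
  rewrite exprMn sqr_sqrtr//; nra.
- rewrite -(ler_pXn2r (n := 2))// ?nnegrE ?mulr_ge0 ?sqrtr_ge0//.
  rewrite exprMn sqr_sqrtr//; nra.
Qed.

(** Since the slope d Z / d X increases with u, a secant is steeper than the
    tangent at its lower end and flatter than the one at its upper end. This squeezes
    unit secants, also where X' = 0 or Z' is infinite. *)
Lemma clasp_secant u w : 0 <= u -> u < w -> w <= 1 ->
  let L := Num.sqrt ((X w - X u) ^+ 2 + (Z w - Z u) ^+ 2) in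
  [/\ 0 < L, u <= (Z w - Z u) / L <= w & cosine w <= (X w - X u) / L <= cosine u].
Proof.
move=> u0 uw w1 L.
have dX : 0 < X w - X u by rewrite subr_gt0 lt_clasp_X.
have dZ : 0 <= Z w - Z u by rewrite subr_ge0 le_clasp_Z// ltW.
have L0 : 0 < L by rewrite sqrtr_gt0 ltr_pwDl ?sqr_ge0// exprn_gt0.
have w0 : 0 <= w by lra.
have u01 : 0 <= u <= 1 by lra.
have w01 : 0 <= w <= 1 by lra.
have lo : u * (X w - X u) <= cosine u * (Z w - Z u).
  have [t tuw E] := clasp_mean u (cosine u) u0 uw w1.
  suff : u * X w - cosine u * Z w - (u * X u - cosine u * Z u) <= 0 by lra.
  rewrite E; have /andP[d0 _] := @clasp_dX_itv R t ltac:(lra).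
  have ct := @cosine_gt0 R t ltac:(lra).
  have cut : cosine t <= cosine u by apply: le_cosine; lra.
  suff : u <= cosine u * slope t.
    move=> H; rewrite mulr_le0_ge0 ?subr_ge0 ?(ltW uw)//.
    by rewrite mulr_ge0_le0 ?(ltW d0)// subr_le0.
  rewrite /slope mulrA ler_pdivlMr//; nra.
have hi : cosine w * (Z w - Z u) <= w * (X w - X u).
  have [t tuw E] := clasp_mean w (cosine w) u0 uw w1.
  suff : 0 <= w * X w - cosine w * Z w - (w * X u - cosine w * Z u) by lra.
  rewrite E; have /andP[d0 _] := @clasp_dX_itv R t ltac:(lra).
  have ct := @cosine_gt0 R t ltac:(lra).
  have cut : cosine w <= cosine t by apply: le_cosine; lra.
  suff : cosine w * slope t <= w.
    move=> H; apply: mulr_ge0; last by lra.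
    by apply: mulr_ge0; [exact: ltW|lra].
  rewrite /slope mulrA ler_pdivrMr//; have := cosine_ge0 w; nra.
have [A B] := unit_coords_le u0 (cosine_ge0 u)
  ltac:(rewrite sqr_cosine//; ring) (ltW dX) dZ lo.
have [C D] := unit_coords_le (cosine_ge0 w) w0
  ltac:(rewrite sqr_cosine//; ring) dZ (ltW dX) hi.
rewrite addrC -/L in C D; split => //.
- by rewrite ler_pdivlMr// ler_pdivrMr// A D.
- by rewrite ler_pdivlMr// ler_pdivrMr// C B.
Qed.

End ClaspDistance.

(** * Vectors in the planes of the two ropes *)

Section Planar.
Context {R : realType}.
Implicit Types (i : bool) (a b : R) (p : 'rV[R]_3).

Lemma row3P p p' : x1_of p = x1_of p' -> x2_of p = x2_of p' ->
  z_of p = z_of p' -> p = p'.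
Proof.
move=> e1 e2 e3; apply/rowP => -[[|[|[|//]]] hk].
- by move: e1; rewrite /x1_of; congr (p 0 _ = p' 0 _); apply/val_inj; rewrite /= inordK.
- by move: e2; rewrite /x2_of; congr (p 0 _ = p' 0 _); apply/val_inj; rewrite /= inordK.
- by move: e3; rewrite /z_of; congr (p 0 _ = p' 0 _); apply/val_inj; rewrite /= inordK.
Qed.

Lemma x1_vec3 (x1 x2 z : R) : x1_of (vec3 x1 x2 z) = x1.
Proof. by rewrite /x1_of mxE inordK. Qed.

Lemma x2_vec3 (x1 x2 z : R) : x2_of (vec3 x1 x2 z) = x2.
Proof. by rewrite /x2_of mxE inordK. Qed.

Lemma z_vec3 (x1 x2 z : R) : z_of (vec3 x1 x2 z) = z.
Proof. by rewrite /z_of mxE inordK. Qed.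

Lemma x1B p p' : x1_of (p - p') = x1_of p - x1_of p'.
Proof. by rewrite /x1_of !mxE. Qed.

Lemma x2B p p' : x2_of (p - p') = x2_of p - x2_of p'.
Proof. by rewrite /x2_of !mxE. Qed.

Lemma zB p p' : z_of (p - p') = z_of p - z_of p'.
Proof. by rewrite /z_of !mxE. Qed.

Lemma x1D p p' : x1_of (p + p') = x1_of p + x1_of p'.
Proof. by rewrite /x1_of !mxE. Qed.

Lemma x2D p p' : x2_of (p + p') = x2_of p + x2_of p'.
Proof. by rewrite /x2_of !mxE. Qed.

Lemma zD p p' : z_of (p + p') = z_of p + z_of p'.
Proof. by rewrite /z_of !mxE. Qed.

Lemma x1Z k p : x1_of (k *: p) = k * x1_of p.
Proof. by rewrite /x1_of !mxE. Qed.

Lemma x2Z k p : x2_of (k *: p) = k * x2_of p.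
Proof. by rewrite /x2_of !mxE. Qed.

Lemma zZ k p : z_of (k *: p) = k * z_of p.
Proof. by rewrite /z_of !mxE. Qed.

Definition coordE :=
  (x1_vec3, x2_vec3, z_vec3, x1B, x2B, zB, x1D, x2D, zD, x1Z, x2Z, zZ).

Lemma dotE p p' : dot p p' =
  x1_of p * x1_of p' + x2_of p * x2_of p' + z_of p * z_of p'.
Proof.
rewrite /dot !big_ord_recl big_ord0 addr0 addrA /x1_of /x2_of /z_of.
by congr (p 0 _ * p' 0 _ + p 0 _ * p' 0 _ + p 0 _ * p' 0 _);
  apply/val_inj; rewrite /= inordK.
Qed.

(** The planes of beta (false) and gamma (true), identified with one plane in such
    a way that both curves become the same one: gamma is beta with x1 and x2
    exchanged and turned upside down. *)
Definition planar i a b : 'rV[R]_3 := if i then vec3 0 a (- b) else vec3 a 0 b.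

(** The coordinates in that plane of the orthogonal projection of a vector. *)
Definition along i p : R := if i then x2_of p else x1_of p.

Definition up i p : R := if i then - z_of p else z_of p.

Lemma along_planar i a b : along i (planar i a b) = a.
Proof. by case: i; rewrite /= ?coordE. Qed.

Lemma up_planar i a b : up i (planar i a b) = b.
Proof. by case: i; rewrite /= ?coordE ?opprK. Qed.

Lemma dot_planar i a b p : dot p (planar i a b) = along i p * a + up i p * b.
Proof. by case: i; rewrite dotE ?coordE/=; ring. Qed.

Lemma planarB i a b a' b' :
  planar i a b - planar i a' b' = planar i (a - a') (b - b').
Proof.
by case: i; apply: row3P; rewrite !coordE; ring.
Qed.

Lemma planarZ i k a b : k *: planar i a b = planar i (k * a) (k * b).
Proof.
by case: i; apply: row3P; rewrite !coordE; ring.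
Qed.

Lemma enorm_planar i a b : enorm (planar i a b) = Num.sqrt (a ^+ 2 + b ^+ 2).
Proof. by rewrite /enorm dot_planar along_planar up_planar -!expr2. Qed.

Lemma cvg_planar (T : Type) (F : set_system T) {FF : Filter F} i (f g : T -> R) a b :
  f @ F --> a -> g @ F --> b -> (fun t => planar i (f t) (g t)) @ F --> planar i a b.
Proof.
have E k l : planar i k l = k *: planar i 1 0 + l *: planar i 0 1.
  by case: i; apply: row3P; rewrite !coordE; ring.
move=> fa gb; rewrite E; under eq_fun do rewrite E.
by apply: cvgD; apply: cvgZ; [|exact: cvg_cst| |exact: cvg_cst].
Qed.

End Planar.

(** * The pieces of the curves *)

Section Curve.
Context {R : realType}.
Variable c : R.
Implicit Types (s r u : R) (i : bool).
Local Notation X := (clasp_X (R := R)).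
Local Notation Z := (clasp_Z (R := R)).
Local Notation h := (clasp_h R).

Lemma half_beta1 s : s <= 1 -> half_beta c s = vec3 1 0 (- c + c * s).
Proof. by rewrite /half_beta => ->. Qed.

(** On each piece the formula also holds at the first end, where half_beta is
    defined by the formula of the preceding piece. *)
Lemma half_beta2 s : 1 <= s <= 2 ->
  half_beta c s = vec3 (X (2 - s)) 0 (h - Z (2 - s)).
Proof.
move=> /andP[+ s2]; rewrite le_eqVlt => /predU1P[<-|s1].
  by rewrite half_beta1// mulr1 addNr (_ : 2 - 1 = 1) ?clasp_X1 ?subrr//; lra.
by rewrite /half_beta leNgt s1/= s2.
Qed.

Lemma half_beta3 s : 2 <= s <= 3 ->
  half_beta c s = vec3 (- X (s - 2)) 0 (h + Z (s - 2)).
Proof.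
move=> /andP[+ s3]; rewrite le_eqVlt => /predU1P[<-|s2].
  rewrite half_beta2; last by lra.
  by rewrite subrr clasp_X0 clasp_Z0 oppr0.
rewrite /half_beta [s <= 1]leNgt [s <= 2]leNgt s2 s3.
by have -> : 1 < s by lra.
Qed.

Lemma half_beta4 s : 3 <= s -> half_beta c s = vec3 (- X (4 - s)) 0 (3 * h - Z (4 - s)).
Proof.
rewrite le_eqVlt => /predU1P[<-|s3].
  rewrite half_beta3; last by lra.
  rewrite (_ : 3 - 2 = 1); last by ring.
  rewrite (_ : 4 - 3 = 1); last by ring.
  by congr vec3; rewrite /clasp_h; ring.
rewrite /half_beta [s <= 1]leNgt [s <= 2]leNgt [s <= 3]leNgt s3.
have -> : 1 < s by lra.
by have -> : 2 < s by lra.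
Qed.

Lemma beta_first s : s <= 4 -> beta c s = half_beta c s.
Proof. by rewrite /beta => ->. Qed.

Lemma beta_second s : 4 <= s -> beta c s = mirror (half_beta c (8 - s)).
Proof.
rewrite le_eqVlt => /predU1P[<-|s4]; last by rewrite /beta leNgt s4.
rewrite beta_first// (_ : 8 - 4 = 4); last by ring.
by rewrite half_beta4 ?ler_nat// subrr clasp_X0 /mirror !coordE !oppr0.
Qed.

Lemma mirror_vec3 (a b z : R) : mirror (vec3 a b z) = vec3 (- a) b z.
Proof. by rewrite /mirror !coordE. Qed.

Definition beta_x s : R := x1_of (beta c s).
Definition beta_z s : R := z_of (beta c s).

Lemma beta_planar s : beta c s = vec3 (beta_x s) 0 (beta_z s).
Proof.
have E r : half_beta c r = vec3 (x1_of (half_beta c r)) 0 (z_of (half_beta c r)).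
  by rewrite /half_beta; case: ifP => _; last (case: ifP => _; last case: ifP => _);
    rewrite !coordE.
rewrite /beta_x /beta_z /beta; case: ifP => _ //.
by rewrite /mirror {2}E !coordE.
Qed.

Definition curve_of i : R -> 'rV[R]_3 := if i then gamma c else beta c.

Lemma curve_planar i s : curve_of i s =
  planar i (beta_x s) (beta_z s) + vec3 0 0 (if i then 3 * h else 0).
Proof.
rewrite /curve_of; case: i; last first.
  by rewrite beta_planar; apply: row3P; rewrite !coordE addr0.
by rewrite /gamma beta_planar /swap_flip; apply: row3P; rewrite !coordE; ring.
Qed.

Lemma curveB i s r : curve_of i s - curve_of i r =
  planar i (beta_x s - beta_x r) (beta_z s - beta_z r).
Proof. have addBK (p q v : 'rV[R]_3) : p + v - (q + v) = p - q.
  by rewrite opprD addrACA subrr addr0.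
by rewrite !curve_planar addBK planarB. Qed.

Definition tent s : R := Num.max 0 (1 - `|s|).

(** The unit tangent of beta is (tangent_x, 0, tangent_z). On each clasp arc just
    one of the summands varies. *)
Definition tangent_x s : R := - cosine (s - 2) + cosine (s - 4) - cosine (s - 6).

Definition tangent_z s : R := tent (s - 6) - tent (s - 2) - clip (-1) 1 (s - 4).

Lemma tent_pos s : 0 <= s <= 1 -> tent s = 1 - s.
Proof. by move=> s01; rewrite /tent ger0_norm ?max_r//; lra. Qed.

Lemma tent_neg s : -1 <= s <= 0 -> tent s = 1 + s.
Proof. by move=> s01; rewrite /tent ler0_norm ?opprK ?max_r//; lra. Qed.

Lemma tent_out s : 1 <= `|s| -> tent s = 0.
Proof. by move=> s1; rewrite /tent max_l//; lra. Qed.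

Lemma clip_ge (a b x : R) : a <= b -> b <= x -> clip a b x = b.
Proof. by move=> ab bx; rewrite /clip min_l// max_r. Qed.

Lemma clip_le (a b x : R) : a <= b -> x <= a -> clip a b x = a.
Proof. by move=> ab xa; rewrite /clip min_r ?max_l//; apply: le_trans xa ab. Qed.

Lemma norm_ge1 (x : R) : 1 <= x \/ x <= -1 -> 1 <= `|x|.
Proof. by rewrite ler_normr => -[->//|x1]; apply/orP; right; lra. Qed.

(** The piece of beta over [lo, lo + 1] is a clasp arc with parameter
    u = q (s - p): sigma tells on which side of the axis it lies, kappa whether
    height grows with u. *)
Record clasp_piece (lo p q sigma kappa C : R) : Prop := ClaspPiece {
  piece_dir : (q = 1 /\ lo = p) \/ (q = - 1 /\ lo = p - 1);
  piece_sigma : sigma = 1 \/ sigma = - 1;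
  piece_kappa : kappa = 1 \/ kappa = - 1;
  piece_x : forall s, lo <= s <= lo + 1 -> beta_x s = sigma * X (q * (s - p));
  piece_z : forall s, lo <= s <= lo + 1 -> beta_z s = C + kappa * Z (q * (s - p));
  piece_tx : forall s, lo <= s <= lo + 1 ->
    tangent_x s = q * sigma * cosine (q * (s - p));
  piece_tz : forall s, lo <= s <= lo + 1 ->
    tangent_z s = q * kappa * (q * (s - p)) }.

Let cosine_far s : 1 <= s \/ s <= -1 -> cosine s = 0.
Proof. by move=> s1; apply: cosine_out; exact: norm_ge1. Qed.

Let tent_far s : 1 <= s \/ s <= -1 -> tent s = 0.
Proof. by move=> s1; apply: tent_out; exact: norm_ge1. Qed.

Lemma clasp_piece1 : clasp_piece 1 2 (-1) 1 (-1) h.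
Proof.
split; [right; split; lra|by left|by right|..] => s s12.
- rewrite /beta_x beta_first ?half_beta2 ?coordE; [|lra|lra].
  by rewrite mul1r mulN1r opprB.
- rewrite /beta_z beta_first ?half_beta2 ?coordE; [|lra|lra].
  by rewrite !mulN1r opprB.
- rewrite /tangent_x (@cosine_far (s - 4)) ?(@cosine_far (s - 6)); [|lra|lra].
  by rewrite !mulN1r cosineN; ring.
- rewrite /tangent_z (@tent_far (s - 6)) ?(@tent_neg (s - 2)) ?clip_le; try lra.
Qed.

Lemma clasp_piece2 : clasp_piece 2 2 1 (-1) 1 h.
Proof.
split; [left; split; lra|by right|by left|..] => s s12.
- rewrite /beta_x beta_first ?half_beta3 ?coordE; [|lra|lra].
  by rewrite mul1r mulN1r.
- rewrite /beta_z beta_first ?half_beta3 ?coordE; [|lra|lra].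
  by rewrite !mul1r.
- rewrite /tangent_x (@cosine_far (s - 4)) ?(@cosine_far (s - 6)); [|lra|lra].
  by rewrite !mul1r; ring.
- rewrite /tangent_z (@tent_far (s - 6)) ?(@tent_pos (s - 2)) ?clip_le; try lra.
Qed.

Lemma clasp_piece3 : clasp_piece 3 4 (-1) (-1) (-1) (3 * h).
Proof.
split; [right; split; lra|by right|by right|..] => s s12.
- rewrite /beta_x beta_first ?half_beta4 ?coordE; [|lra|lra].
  by rewrite !mulN1r opprB.
- rewrite /beta_z beta_first ?half_beta4 ?coordE; [|lra|lra].
  by rewrite !mulN1r opprB.
- rewrite /tangent_x (@cosine_far (s - 2)) ?(@cosine_far (s - 6)); [|lra|lra].
  by rewrite !mulN1r cosineN; ring.
- rewrite /tangent_z (@tent_far (s - 6)) ?(@tent_far (s - 2)) ?clip_id; try lra.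
Qed.

Lemma clasp_piece4 : clasp_piece 4 4 1 1 (-1) (3 * h).
Proof.
split; [left; split; lra|by left|by right|..] => s s12.
- rewrite /beta_x beta_second ?half_beta4 ?mirror_vec3 ?coordE; [|lra|lra].
  by rewrite opprK !mul1r (_ : 4 - (8 - s) = s - 4)//; ring.
- rewrite /beta_z beta_second ?half_beta4 ?mirror_vec3 ?coordE; [|lra|lra].
  by rewrite mul1r mulN1r (_ : 4 - (8 - s) = s - 4)//; ring.
- rewrite /tangent_x (@cosine_far (s - 2)) ?(@cosine_far (s - 6)); [|lra|lra].
  by rewrite !mul1r; ring.
- rewrite /tangent_z (@tent_far (s - 6)) ?(@tent_far (s - 2)) ?clip_id; try lra.
Qed.

Lemma clasp_piece5 : clasp_piece 5 6 (-1) 1 1 h.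
Proof.
split; [right; split; lra|by left|by left|..] => s s12.
- rewrite /beta_x beta_second ?half_beta3 ?mirror_vec3 ?coordE; [|lra|lra].
  by rewrite opprK mul1r (_ : 8 - s - 2 = -1 * (s - 6))//; ring.
- rewrite /beta_z beta_second ?half_beta3 ?mirror_vec3 ?coordE; [|lra|lra].
  by rewrite mul1r (_ : 8 - s - 2 = -1 * (s - 6))//; ring.
- rewrite /tangent_x (@cosine_far (s - 2)) ?(@cosine_far (s - 4)); [|lra|lra].
  by rewrite !mulN1r cosineN; ring.
- rewrite /tangent_z (@tent_neg (s - 6)) ?(@tent_far (s - 2)) ?clip_ge; try lra.
Qed.

Lemma clasp_piece6 : clasp_piece 6 6 1 (-1) (-1) h.
Proof.
split; [left; split; lra|by right|by right|..] => s s12.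
- rewrite /beta_x beta_second ?half_beta2 ?mirror_vec3 ?coordE; [|lra|lra].
  by rewrite mulN1r (_ : 2 - (8 - s) = 1 * (s - 6))//; ring.
- rewrite /beta_z beta_second ?half_beta2 ?mirror_vec3 ?coordE; [|lra|lra].
  by rewrite mulN1r (_ : 2 - (8 - s) = 1 * (s - 6))//; ring.
- rewrite /tangent_x (@cosine_far (s - 2)) ?(@cosine_far (s - 4)); [|lra|lra].
  by rewrite !mul1r; ring.
- rewrite /tangent_z (@tent_pos (s - 6)) ?(@tent_far (s - 2)) ?clip_ge; try lra.
Qed.

Lemma first_segment s : 0 <= s <= 1 -> [/\ beta_x s = 1,
  beta_z s = - c + c * s, tangent_x s = 0 & tangent_z s = 1].
Proof.
move=> s01; rewrite /beta_x /beta_z beta_first ?half_beta1 ?coordE; [|lra|lra].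
split => //.
- by rewrite /tangent_x !cosine_far; lra.
- by rewrite /tangent_z !tent_far ?clip_le; lra.
Qed.

Lemma last_segment s : 7 <= s <= 8 -> [/\ beta_x s = - 1,
  beta_z s = - c + c * (8 - s), tangent_x s = 0 & tangent_z s = - 1].
Proof.
move=> s01; rewrite /beta_x /beta_z beta_second ?half_beta1 ?mirror_vec3 ?coordE;
  [|lra|lra].
split => //.
- by rewrite /tangent_x !cosine_far; lra.
- by rewrite /tangent_z !tent_far ?clip_ge; lra.
Qed.

End Curve.

(** * Gluing along a subdivision *)

Section Gluing.
Context {R : realType}.
Implicit Types (f : R -> R) (a b d : R).
Local Notation BV := bounded_variation.

Lemma within_continuous_cat f a b d :
  {within `[a, b], continuous f} -> {within `[b, d], continuous f} ->
  {within `[a, d], continuous f}.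
Proof.
move=> f1 f2; apply: (@continuous_subspaceW _ _ _ (`[a, b] `|` `[b, d])).
  move=> x /=; rewrite !in_itv/= => /andP[ax xd].
  by have [xb|/ltW bx] := leP x b; [left; rewrite ax|right; rewrite bx xd].
by apply: withinU_continuous => //; exact: interval_closed.
Qed.

Lemma bounded_variation_cat f a b d : a <= b -> b <= d ->
  BV a b f -> BV b d f -> BV a d f.
Proof.
move=> ab bd /(bounded_variationP _ ab) f1 /(bounded_variationP _ bd) f2.
apply/bounded_variationP; first exact: le_trans ab bd.
by rewrite (total_variationD _ ab bd) fin_numD f1.
Qed.

Lemma nonincreasing_bounded_variation f a b :
  (forall x y, a <= x -> x <= y -> y <= b -> f y <= f x) -> BV a b f.
Proof.
move=> fni; have -> : f = \- (\- f) by apply/funext => x /=; rewrite opprK.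
apply: bounded_variationN; apply: nondecreasing_bounded_variation.
move=> x y; rewrite !in_itv/= => /andP[ax xb] /andP[ay yb] xy.
by rewrite lerN2 fni.
Qed.

(** Monotone on either side of p. *)
Lemma even_bounded_variation f a b p : a <= p -> p <= b ->
  (forall x, f (- x) = f x) -> (forall x y, 0 <= x -> x <= y -> f y <= f x) ->
  BV a b (fun s => f (s - p)).
Proof.
move=> ap pb fN fni; apply: (bounded_variation_cat ap pb).
- apply: nondecreasing_bounded_variation.
  move=> x y; rewrite !in_itv/= => /andP[ax xb] /andP[ay yb] xy.
  by rewrite -(fN (x - p)) -(fN (y - p)); apply: fni; lra.
- by apply: nonincreasing_bounded_variation => x y px xy yb; apply: fni; lra.
Qed.

Lemma chain_segments (P : R -> R -> Prop) :
  (forall a b d, a <= b -> b <= d -> P a b -> P b d -> P a d) ->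
  P 0 1 -> P 1 2 -> P 2 3 -> P 3 4 -> P 4 5 -> P 5 6 -> P 6 7 -> P 7 8 -> P 0 8.
Proof.
move=> cat p0 p1 p2 p3 p4 p5 p6 p7.
apply: (cat _ 7) ; [lra|lra| |done]; apply: (cat _ 6) ; [lra|lra| |done].
apply: (cat _ 5) ; [lra|lra| |done]; apply: (cat _ 4) ; [lra|lra| |done].
apply: (cat _ 3) ; [lra|lra| |done]; apply: (cat _ 2) ; [lra|lra| |done].
by apply: (cat _ 1) => //; lra.
Qed.

End Gluing.

(** * Regularity of the curves and of their tangents *)

Section CurveRegularity.
Context {R : realType}.
Variable c : R.
Implicit Types (s r u : R) (i : bool).
Local Notation X := (clasp_X (R := R)).
Local Notation Z := (clasp_Z (R := R)).
Local Notation h := (clasp_h R).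
Local Notation tx := (tangent_x (R := R)).
Local Notation tz := (tangent_z (R := R)).
Local Notation BV := bounded_variation.
Local Notation bx := (beta_x c).
Local Notation bz := (beta_z c).

Lemma continuous_shift (f : R -> R) p : continuous f -> continuous (fun s => f (s - p)).
Proof.
move=> cf s; apply: (@continuous_comp _ _ _ (fun s => s - p) f); last exact: cf.
by apply: continuousB; [exact: cvg_id|exact: cst_continuous].
Qed.

Lemma continuous_tangent_x : continuous tx.
Proof.
move=> s; have cs p := @continuous_shift _ p (@continuous_cosine R) s.
apply: cvgB; first apply: cvgD; first apply: cvgN.
all: exact: cs.
Qed.

Lemma continuous_tent : continuous (@tent R).
Proof.
apply: max_fun_continuous; first by move=> ?; exact: cst_continuous.
move=> s; apply: continuousB; first exact: cst_continuous.
exact: norm_continuous.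
Qed.

Lemma continuous_tangent_z : continuous tz.
Proof.
move=> s; have ct p := @continuous_shift _ p continuous_tent s.
apply: cvgB; first by apply: cvgB; exact: ct.
exact: (@continuous_shift _ 4 (@continuous_clip R (-1) 1) s).
Qed.

Lemma bounded_variation_tangent_x : BV 0 8 tx.
Proof.
have bc p : 0 <= p <= 8 -> BV 0 8 (fun s => cosine (s - p)).
  move=> /andP[p0 p8]; apply: even_bounded_variation => //; first exact: cosineN.
  exact: le_cosine.
have lt08 : 0 < 8 :> R by [].
apply: (@bounded_variationD _ _ _ (fun s => - cosine (s - 2) + cosine (s - 4))
  (fun s => - cosine (s - 6))) => //.
  apply: (@bounded_variationD _ _ _ (fun s => - cosine (s - 2))) => //.
    by apply: bounded_variationN; apply: bc; lra.
  by apply: bc; lra.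
by apply: bounded_variationN; apply: bc; lra.
Qed.

Lemma bounded_variation_tangent_z : BV 0 8 tz.
Proof.
have bc p : 0 <= p <= 8 -> BV 0 8 (fun s => tent (s - p)).
  move=> /andP[p0 p8]; apply: even_bounded_variation => //.
    by move=> x; rewrite /tent normrN.
  move=> x y x0 xy; rewrite /tent !ger0_norm//; last exact: le_trans xy.
  by rewrite ge_max le_max lexx/= le_max lerD2l lerN2 xy orbT.
have lt08 : 0 < 8 :> R by [].
apply: (@bounded_variationD _ _ _ (fun s => tent (s - 6) - tent (s - 2))
  (fun s => - clip (-1) 1 (s - 4))) => //.
  apply: (@bounded_variationD _ _ _ (fun s => tent (s - 6))) => //.
    by apply: bc; lra.
  by apply: bounded_variationN; apply: bc; lra.
apply: nonincreasing_bounded_variation => x y _ xy _.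
rewrite lerN2 /clip ge_max le_max lexx/= le_max; apply/orP; right.
by rewrite le_min !ge_min lexx/= lerD2r xy orbT.
Qed.

Lemma piece_continuous lo hi p q sigma kappa C :
  clasp_piece c lo p q sigma kappa C -> hi = lo + 1 ->
  {within `[lo, hi], continuous bx} /\ {within `[lo, hi], continuous bz}.
Proof.
move=> [pq _ _ xE zE _ _] ->.
have u01 s : lo <= s <= lo + 1 -> 0 <= q * (s - p) <= 1.
  by case: pq => -[-> ->]; lra.
have caff (f : R -> R) : continuous f -> continuous (fun s => f (q * (s - p))).
  move=> cf s; apply: (@continuous_comp _ _ _ (fun s => q * (s - p)) f); last exact: cf.
  apply: continuousM; first exact: cst_continuous.
  by apply: continuousB; [exact: cvg_id|exact: cst_continuous].
have cX : continuous (X \o clip 0 1).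
  apply: continuous_comp_clip => //.
  rewrite continuous_subspace_in => x /set_mem/=; rewrite in_itv/= => x01.
  apply: continuous_subspaceT_for; first by rewrite /= in_itv.
  exact: continuous_clasp_X.
split.
- apply: (@subspace_eq_continuous _ _ _
    (fun s => sigma * (X \o clip 0 1) (q * (s - p)))).
    move=> s; rewrite inE/= in_itv/= => sl.
    by rewrite /from_subspace/= clip_id ?xE ?u01.
  apply: continuous_subspaceT => s; apply: cvgM; first exact: cvg_cst.
  exact: caff.
- apply: (@subspace_eq_continuous _ _ _
    (fun s => C + kappa * (Z \o clip 0 1) (q * (s - p)))).
    move=> s; rewrite inE/= in_itv/= => sl.
    by rewrite /from_subspace/= clip_id ?zE ?u01.
  apply: continuous_subspaceT => s; apply: cvgD; first exact: cvg_cst.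
  apply: cvgM; first exact: cvg_cst.
  by apply: caff; apply: continuous_comp_clip ler01 continuous_clasp_Z.
Qed.

Lemma within_continuous_segment (f g : R -> R) a b : continuous g ->
  (forall s, a <= s <= b -> f s = g s) -> {within `[a, b], continuous f}.
Proof.
move=> cg fg; apply: (@subspace_eq_continuous _ _ _ g).
  by move=> s; rewrite inE/= in_itv/= => sl; rewrite /from_subspace fg.
exact: continuous_subspaceT.
Qed.

Lemma continuous_beta :
  {within `[0, 8], continuous bx} /\ {within `[0, 8], continuous bz}.
Proof.
have cid : continuous (fun s : R => s) by move=> s; exact: cvg_id.
have cc (k : R) : continuous (fun _ : R => k) by move=> s; exact: cst_continuous.
have x0 : {within `[0, 1], continuous bx}.
  by apply: (within_continuous_segment (cc 1)) => s /(first_segment c)[].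
have z0 : {within `[0, 1], continuous bz}.
  apply: (@within_continuous_segment _ (fun s => - c + c * s)).
    by move=> s; apply: cvgD; [|apply: cvgM]; try exact: cvg_cst; exact: cvg_id.
  by move=> s /(first_segment c)[].
have x7 : {within `[7, 8], continuous bx}.
  by apply: (within_continuous_segment (cc (-1))) => s /(last_segment c)[].
have z7 : {within `[7, 8], continuous bz}.
  apply: (@within_continuous_segment _ (fun s => - c + c * (8 - s))).
    move=> s; apply: cvgD; first exact: cvg_cst.
    apply: cvgM; first exact: cvg_cst.
    by apply: cvgB; [exact: cvg_cst|exact: cvg_id].
  by move=> s /(last_segment c)[].
have [x1 z1] := piece_continuous (hi := 2) (clasp_piece1 c) ltac:(lra).
have [x2 z2] := piece_continuous (hi := 3) (clasp_piece2 c) ltac:(lra).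
have [x3 z3] := piece_continuous (hi := 4) (clasp_piece3 c) ltac:(lra).
have [x4 z4] := piece_continuous (hi := 5) (clasp_piece4 c) ltac:(lra).
have [x5 z5] := piece_continuous (hi := 6) (clasp_piece5 c) ltac:(lra).
have [x6 z6] := piece_continuous (hi := 7) (clasp_piece6 c) ltac:(lra).
split; apply: (chain_segments (P := fun a b => {within `[a, b], continuous _})) => //.
all: by move=> a b d _ _; exact: within_continuous_cat.
Qed.

End CurveRegularity.

(** * Unit tangents *)

Section Tangents.
Context {R : realType}.
Variable c : R.
Hypothesis c0 : 0 < c.
Implicit Types (s r u : R) (i : bool).
Local Notation X := (clasp_X (R := R)).
Local Notation Z := (clasp_Z (R := R)).
Local Notation h := (clasp_h R).
Local Notation tx := (tangent_x (R := R)).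
Local Notation tz := (tangent_z (R := R)).
Local Notation bx := (beta_x c).
Local Notation bz := (beta_z c).

(** A form of the squeezing of secants between tangents in which the signs and the
    direction of a piece do not appear. *)
Definition secant_near_tangent s r : Prop :=
  let L := Num.sqrt ((bx r - bx s) ^+ 2 + (bz r - bz s) ^+ 2) in
  `|(bx r - bx s) / L - tx s| <= `|tx r - tx s| /\
  `|(bz r - bz s) / L - tz s| <= `|tz r - tz s|.

Lemma normalize_curve i s r :
  let L := Num.sqrt ((bx r - bx s) ^+ 2 + (bz r - bz s) ^+ 2) in
  normalize (curve_of c i r - curve_of c i s) =
  planar i ((bx r - bx s) / L) ((bz r - bz s) / L).
Proof.
by rewrite /normalize curveB enorm_planar planarZ ![_^-1 * _]mulrC.
Qed.

Lemma sqr_unit (k : R) : k = 1 \/ k = -1 -> k ^+ 2 = 1.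
Proof. by move=> [->|->]; rewrite ?sqrrN expr1n. Qed.

Lemma piece_secant lo p q sigma kappa C s r : clasp_piece c lo p q sigma kappa C ->
  lo <= s -> s < r -> r <= lo + 1 -> secant_near_tangent s r.
Proof.
move=> [pq sg kp xE zE txE tzE] ls sr rl.
have sl : lo <= s <= lo + 1 by lra.
have rl' : lo <= r <= lo + 1 by lra.
rewrite /secant_near_tangent !txE// !tzE//.
set us := q * (s - p); set ur := q * (r - p).
have -> : bx r - bx s = sigma * (X ur - X us) by rewrite !xE// /ur /us; ring.
have -> : bz r - bz s = kappa * (Z ur - Z us) by rewrite !zE// /ur /us; ring.
rewrite !exprMn (sqr_unit sg) (sqr_unit kp) !mul1r.
have unitB (k A a b : R) : k = 1 \/ k = -1 -> `|A - q * a| <= `|q * b - q * a| ->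
    `|k * A - q * k * a| <= `|q * k * b - q * k * a|.
  move=> k1 H; have -> : k * A - q * k * a = k * (A - q * a) by ring.
  have -> : q * k * b - q * k * a = k * (q * b - q * a) by ring.
  by rewrite !normrM ler_wpM2l.
rewrite -!(mulrA _ _ (_^-1)).
suff : `|(X ur - X us) / Num.sqrt ((X ur - X us) ^+ 2 + (Z ur - Z us) ^+ 2) -
         q * cosine us| <= `|q * cosine ur - q * cosine us| /\
       `|(Z ur - Z us) / Num.sqrt ((X ur - X us) ^+ 2 + (Z ur - Z us) ^+ 2) -
         q * us| <= `|q * ur - q * us|.
  by move=> [H1 H2]; split; apply: unitB.
case: pq @us @ur {xE zE txE tzE unitB} sl rl' => -[-> ->] us ur sl rl'.
- have [L0 /andP[z1 z2] /andP[x1 x2]] := @clasp_secant R us ur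
    ltac:(rewrite /us; lra) ltac:(rewrite /us /ur; lra) ltac:(rewrite /ur; lra).
  rewrite !mul1r; split.
    by rewrite !ler0_norm ?subr_le0 ?(le_trans x1)//; lra.
  by rewrite !ger0_norm ?subr_ge0 ?(le_trans z1)//; lra.
- have [L0 /andP[z1 z2] /andP[x1 x2]] := @clasp_secant R ur us
    ltac:(rewrite /ur; lra) ltac:(rewrite /us /ur; lra) ltac:(rewrite /us; lra).
  rewrite -[X ur - _]opprB -[Z ur - _]opprB !sqrrN !mulN1r !mulNr !opprK.
  split.
    rewrite !ler0_norm; lra.
  rewrite !ger0_norm; lra.
Qed.

Lemma vertical_secant s r (e : R) : bx r = bx s -> tx s = 0 -> tx r = 0 ->
  tz s = e -> tz r = e -> bz r - bz s = e * `|bz r - bz s| -> bz r - bz s != 0 ->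
  secant_near_tangent s r.
Proof.
move=> xE txs txr tzs tzr zE z0; rewrite /secant_near_tangent xE txs txr tzs tzr.
move: (bx s) (bz r - bz s) zE z0 => x d dE d0.
have -> : d / Num.sqrt ((x - x) ^+ 2 + d ^+ 2) = e.
  by rewrite subrr expr0n/= add0r sqrtr_sqr {1}dE mulfK ?normr_eq0.
by rewrite !subrr mul0r subrr.
Qed.

Lemma curve_secant s r (k : nat) : (k < 8)%N ->
  k%:R <= s -> s < r -> r <= k%:R + 1 -> secant_near_tangent s r.
Proof.
case: k => [|[|[|[|[|[|[|[|//]]]]]]]] _.
- move=> s0 sr r1; have csr : 0 < c * (r - s) by rewrite mulr_gt0// subr_gt0.
  have [xs zs txs tzs] := @first_segment R c s ltac:(lra).
  have [xr zr txr tzr] := @first_segment R c r ltac:(lra).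
  have zE : bz r - bz s = c * (r - s) by rewrite zs zr; ring.
  apply: (@vertical_secant _ _ 1); rewrite ?xs ?xr// zE ?gt_eqF//.
  by rewrite mul1r gtr0_norm.
- exact: piece_secant (clasp_piece1 c).
- exact: piece_secant (clasp_piece2 c).
- exact: piece_secant (clasp_piece3 c).
- exact: piece_secant (clasp_piece4 c).
- exact: piece_secant (clasp_piece5 c).
- exact: piece_secant (clasp_piece6 c).
- move=> s0 sr r1; have csr : 0 < c * (r - s) by rewrite mulr_gt0// subr_gt0.
  have [xs zs txs tzs] := @last_segment R c s ltac:(lra).
  have [xr zr txr tzr] := @last_segment R c r ltac:(lra).
  have zE : bz r - bz s = - (c * (r - s)) by rewrite zs zr; ring.
  apply: (@vertical_secant _ _ (-1)); rewrite ?xs ?xr// zE ?oppr_eq0 ?gt_eqF//.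
  by rewrite normrN mulN1r gtr0_norm.
Qed.

Definition curve_tangent i s : 'rV[R]_3 := planar i (tx s) (tz s).

Lemma cvg_le_dist (F : set_system R) {FF : Filter F} (f g : R -> R) (l : R) :
  (\forall r \near F, `|f r - l| <= `|g r - l|) -> g @ F --> l -> f @ F --> l.
Proof.
move=> fg /cvgrPdist_lt gl; apply/cvgrPdist_lt => e e0.
near=> r; rewrite distrC; apply: (@le_lt_trans _ _ `|g r - l|).
  by near: r.
by rewrite distrC; near: r; exact: gl.
Unshelve. all: by end_near. Qed.

(** Whichever piece begins at or contains s, secant_near_tangent reduces the claim
    to the continuity of the tangent coordinates. *)
Lemma cvg_right_secant i s : 0 <= s < 8 ->
  normalize (curve_of c i r - curve_of c i s) @[r --> s^'+] --> curve_tangent i s.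
Proof.
move=> s08.
have /andP[s0 s8] := s08.
have /andP[ks] := truncn_itv s0; set k := Num.trunc s in ks * => sk.
have k8 : (k < 8)%N by rewrite truncn_lt_nat.
rewrite -natr1 in sk.
have near_s : \forall r \near s^'+, s < r <= k%:R + 1.
  near=> r; apply/andP; split => //.
  by near: r; exact: nbhs_right_le.
under eq_fun do rewrite normalize_curve.
apply: cvg_planar.
- apply: (@cvg_le_dist _ _ _ tx).
    apply: filterS near_s => r /andP[sr rk].
    by have [] := curve_secant k8 ks sr rk.
  apply: cvg_at_right_filter; exact: continuous_tangent_x.
- apply: (@cvg_le_dist _ _ _ tz).
    apply: filterS near_s => r /andP[sr rk].
    by have [] := curve_secant k8 ks sr rk.
  apply: cvg_at_right_filter; exact: continuous_tangent_z.
Unshelve. all: by end_near. Qed.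

Lemma cvg_left_secant i :
  normalize (curve_of c i 8 - curve_of c i r) @[r --> 8^'-] --> curve_tangent i 8.
Proof.
apply: (@cvg_trans _ (curve_tangent i 8 @[r --> 8^'-])); last exact: cvg_cst.
apply: near_eq_cvg; near=> r.
have r78 : 7 <= r < 8.
  apply/andP; split; last by [].
  near: r; apply: nbhs_left_ge; lra.
have [_ _ tx8 tz8] := @last_segment R c 8 ltac:(lra).
have [_ _ txr tzr] := @last_segment R c r ltac:(lra).
have [] := @curve_secant r 8 7 isT ltac:(lra) ltac:(lra) ltac:(lra).
rewrite normalize_curve /curve_tangent txr tx8 tzr tz8.
move: (_ / _) (_ / _) => x z; rewrite !subrr normr0 !normr_le0 !subr_eq0.
by move=> /eqP -> /eqP ->.
Unshelve. all: by end_near. Qed.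

End Tangents.

(** * Floor and ceiling *)

Section HorizontalPlanes.
Context {R : realType}.
Implicit Types (p v : 'rV[R]_3) (j : bool).

(** A compatible field is horizontal at the ends of the ropes. *)
Lemma in_horizontal_direction z v :
  (v \in direction (horizontal_plane z)) = (z_of v == 0).
Proof.
rewrite /horizontal_plane/= span_cons span_seq1; apply/idP/eqP.
- move=> /memv_addP[a /vlineP[k ->] [b /vlineP[l ->] ->]].
  by rewrite !coordE !mulr0 addr0.
- move=> v0; have -> : v = x1_of v *: vec3 1 0 0 + x2_of v *: vec3 0 1 0.
    by apply: row3P; rewrite !coordE ?v0; ring.
  by apply: memv_add; apply: memvZ; exact: memv_line.
Qed.

Lemma in_horizontal_plane z p : in_affine (horizontal_plane z) p <-> z_of p = z.
Proof.
rewrite /in_affine in_horizontal_direction/= !coordE subr_eq0.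
by split=> [/eqP//|->].
Qed.

Definition wall (j : bool) (d : R) p : R := if j then d - z_of p else z_of p + d.

Definition wall_sign j : R := if j then -1 else 1.

Lemma wall_shift j d p v k :
  wall j d (k *: v + p) = k * (wall_sign j * z_of v) + wall j d p.
Proof. by rewrite /wall /wall_sign; case: j; rewrite !coordE; ring. Qed.

(** The difference quotients are constant. *)
Lemma derive_wall j d p v : 'D_v (wall j d) p = wall_sign j * z_of v.
Proof.
apply: cvg_lim => //.
apply: (@cvg_trans _ (wall_sign j * z_of v @[k --> (0 : R)^'])); last exact: cvg_cst.
apply: near_eq_cvg; near=> k.
rewrite /= wall_shift addrK /GRing.scale/= mulKf//.
by near: k; exact: nbhs_dnbhs_neq.
Unshelve. all: by end_near. Qed.

Lemma gradient_wall j d p : gradient (wall j d) p = vec3 0 0 (wall_sign j).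
Proof.
apply: row3P; rewrite ?coordE /x1_of /x2_of /z_of mxE derive_wall /z_of mxE/=.
- by rewrite -val_eqE/= !inordK// mulr0.
- by rewrite -val_eqE/= !inordK// mulr0.
- by rewrite eqxx mulr1.
Qed.

Lemma wall_C1 j d : C1 (wall j d).
Proof.
split => [p|].
- have dz : differentiable (@z_of R) p by exact: differentiable_coord.
  rewrite /wall; case: j; first by apply: differentiableB.
  exact: differentiableD.
- have -> : gradient (wall j d) = (fun _ => vec3 0 0 (wall_sign j)).
    by apply/funext => p; exact: gradient_wall.
  by move=> p; exact: cst_continuous.
Qed.

Lemma wall_regular j d : regular_value (wall j d) 0.
Proof.
move=> p _; rewrite gradient_wall; apply/eqP => /(congr1 z_of).
rewrite coordE /z_of mxE => /eqP; apply/negP.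
by rewrite /wall_sign; case: j; rewrite ?oppr_eq0 oner_eq0.
Qed.

End HorizontalPlanes.

(** * Distance between the two ropes *)

Section Distances.
Context {R : realType}.
Variable c : R.
Hypothesis c0 : 0 < c.
Implicit Types (s r u : R) (i : bool).
Local Notation X := (clasp_X (R := R)).
Local Notation Z := (clasp_Z (R := R)).
Local Notation h := (clasp_h R).
Local Notation bx := (beta_x c).
Local Notation bz := (beta_z c).

(** A point of beta lies on one of the vertical segments or on one of three levels
    of clasp arcs. *)
Lemma beta_level s : 0 <= s <= 8 ->
  bx s ^+ 2 = 1 /\ - c <= bz s <= 0 \/
  exists2 u, 0 <= u <= 1 & bx s ^+ 2 = X u ^+ 2 /\
    [\/ bz s = h - Z u, bz s = h + Z u | bz s = 3 * h - Z u].
Proof.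
move=> s08.
have piece lo p q sigma kappa C : clasp_piece c lo p q sigma kappa C ->
    lo <= s <= lo + 1 ->
    exists2 u, 0 <= u <= 1 & bx s ^+ 2 = X u ^+ 2 /\ bz s = C + kappa * Z u.
  move=> [pq sg _ xE zE _ _] sl; exists (q * (s - p)).
    by case: pq sl {xE zE} => -[-> ->]; lra.
  by rewrite xE// zE// exprMn (sqr_unit sg) mul1r.
have [s1|s1] := leP s 1.
  have [-> -> _ _] := @first_segment R c s ltac:(lra).
  have cs : 0 <= c * s by apply: mulr_ge0 (ltW c0) _; lra.
  have cs1 : 0 <= c * (1 - s) by apply: mulr_ge0 (ltW c0) _; lra.
  by left; rewrite expr1n; split=> //; lra.
have [s7|s7] := leP 7 s.
  have [-> -> _ _] := @last_segment R c s ltac:(lra).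
  have cs : 0 <= c * (8 - s) by apply: mulr_ge0 (ltW c0) _; lra.
  have cs1 : 0 <= c * (s - 7) by apply: mulr_ge0 (ltW c0) _; lra.
  by left; rewrite sqrrN expr1n; split=> //; lra.
right.
have [s2|s2] := leP s 2.
  have [|u u01 [xE zE]] := piece _ _ _ _ _ _ (clasp_piece1 c); first lra.
  by exists u => //; split => //; apply: Or31; rewrite zE; ring.
have [s3|s3] := leP s 3.
  have [|u u01 [xE zE]] := piece _ _ _ _ _ _ (clasp_piece2 c); first lra.
  by exists u => //; split => //; apply: Or32; rewrite zE; ring.
have [s4|s4] := leP s 4.
  have [|u u01 [xE zE]] := piece _ _ _ _ _ _ (clasp_piece3 c); first lra.
  by exists u => //; split => //; apply: Or33; rewrite zE; ring.
have [s5|s5] := leP s 5.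
  have [|u u01 [xE zE]] := piece _ _ _ _ _ _ (clasp_piece4 c); first lra.
  by exists u => //; split => //; apply: Or33; rewrite zE; ring.
have [s6|s6] := leP s 6.
  have [|u u01 [xE zE]] := piece _ _ _ _ _ _ (clasp_piece5 c); first lra.
  by exists u => //; split => //; apply: Or32; rewrite zE; ring.
have [|u u01 [xE zE]] := piece _ _ _ _ _ _ (clasp_piece6 c); first lra.
by exists u => //; split => //; apply: Or31; rewrite zE; ring.
Qed.

Lemma beta_height s : 0 <= s <= 8 -> - c <= bz s <= 3 * h.
Proof.
have /andP[_ h0] := @clasp_Z_itv R 0 ltac:(lra); rewrite clasp_Z0 in h0.
move=> /beta_level[[_ zs]|[u u01 [_ zs]]]; first by lra.
have := ltW c0; have := clasp_Z_itv u01; case: zs => ->; lra.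
Qed.

Lemma curve_dist_sqr i s r :
  enorm (curve_of c i s - curve_of c (~~ i) r) ^+ 2 =
  bx s ^+ 2 + bx r ^+ 2 + (bz s + bz r - 3 * h) ^+ 2.
Proof.
rewrite /enorm sqr_sqrtr; last first.
  by rewrite dotE -!expr2 !addr_ge0 ?sqr_ge0.
rewrite !curve_planar; move: (bx s) (bz s) (bx r) (bz r) (h) => x z x' z' k.
by case: i; rewrite dotE /planar/= !coordE; ring.
Qed.

(** The points of the vertical segments are at distance 1 from the plane of the
    other rope. On the arcs the vertical distance for levels that do not face each
    other exceeds the one within a clasp, as 0 <= Z <= h, so clasp_dist applies. *)
Lemma curve_dist_ge1 i s r : 0 <= s <= 8 -> 0 <= r <= 8 ->
  1 <= enorm (curve_of c i s - curve_of c (~~ i) r).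
Proof.
move=> s08 r08; rewrite -(ler_pXn2r (n := 2))// ?nnegrE ?sqrtr_ge0//.
rewrite curve_dist_sqr expr1n.
have [[-> _]|[u u01 [-> zs]]] := beta_level s08.
  by rewrite -addrA lerDl addr_ge0 ?sqr_ge0.
have [[-> _]|[w w01 [-> zr]]] := beta_level r08.
  by rewrite addrAC lerDr addr_ge0 ?sqr_ge0.
apply: le_trans (clasp_dist u01 w01) _; rewrite lerD2l.
have := clasp_Z_itv u01; have := clasp_Z_itv w01.
move: (h) (Z u) (Z w) zs zr => H U W zs zr W0 U0.
by case: zs => ->; case: zr => ->; nra.
Qed.

End Distances.

(** * The generalized link and its thickness *)

Section GrannyLink.
Context {R : realType}.
Variable c : R.
Hypothesis c0 : 0 < c.
Implicit Types (s r u : R) (i : bool).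
Local Notation h := (clasp_h R).
Local Notation BV := bounded_variation.
Local Notation L := (granny_clasp c).

Lemma eq_bounded_variation (a b : R) (f g : R -> R) :
  (forall s, a <= s <= b -> f s = g s) -> BV a b f -> BV a b g.
Proof.
move=> fg [M ubM]; exists M => _ [s abs <-]; apply: ubM.
exists s => //; apply: eq_big_nat => k /andP[_ ks] /=.
have pt m : (m <= size s)%N -> a <= nth b (a :: s) m <= b.
  by move=> ms; rewrite itv_partition_nth_ge ?itv_partition_nth_le.
rewrite (fg (nth b s k)); last exact: (pt k.+1).
by rewrite (fg (nth b (a :: s) k))// pt// ltnW.
Qed.

Lemma granny_unit_tangent i s : 0 <= s <= 8 ->
  @unit_tangent R L i s = curve_tangent i s.
Proof.
move=> /andP[s0 s8]; rewrite /unit_tangent/=.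
case: ifPn => [s8'|].
  apply: cvg_lim; first exact: norm_hausdorff.
  have s08 : 0 <= s < 8 by rewrite s0.
  exact: cvg_right_secant.
rewrite -leNgt => s8''; have -> : s = 8 by apply/eqP; rewrite eq_le s8.
by apply: cvg_lim; [exact: norm_hausdorff|exact: (cvg_left_secant)].
Qed.

Lemma bounded_variation_curve_tangent i (k : 'I_3) :
  BV 0 8 (fun s => curve_tangent i s 0 k).
Proof.
have bx := @bounded_variation_tangent_x R.
have bz := @bounded_variation_tangent_z R.
have b0 : BV 0 8 (fun _ : R => 0 : R) by exact: nondecreasing_bounded_variation.
have bzN : BV 0 8 (fun s => - tangent_z s) by exact: bounded_variationN.
case: k => [[|[|[|//]]] hk]; case: i;
  [apply: eq_bounded_variation b0 | apply: eq_bounded_variation bx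
  |apply: eq_bounded_variation bx | apply: eq_bounded_variation b0
  |apply: eq_bounded_variation bzN| apply: eq_bounded_variation bz];
  by move=> s _; rewrite mxE.
Qed.

Lemma granny_tangent_of_BV i : @tangent_of_BV R L i.
Proof.
split.
- move=> s; rewrite in_itv/= => s08; apply: cvgP; exact: (cvg_right_secant c0).
- apply: cvgP; exact: (cvg_left_secant).
- move=> k; apply: eq_bounded_variation (bounded_variation_curve_tangent i k).
  by move=> s s08 /=; rewrite granny_unit_tangent.
Qed.

Lemma continuous_curve i : {within `[0, 8], continuous (curve_of c i)}.
Proof.
have [cx cz] := continuous_beta c.
rewrite (_ : curve_of c i = fun s => planar i (beta_x c s) (beta_z c s) +
    vec3 0 0 (if i then 3 * h else 0)); last first.
  by apply/funext => s; exact: curve_planar.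
apply/subspace_continuousP => s s08.
apply: cvgD; last exact: cvg_cst.
apply: cvg_planar.
- by move/subspace_continuousP: cx; apply.
- by move/subspace_continuousP: cz; apply.
Qed.

Lemma z_curve i s :
  z_of (curve_of c i s) = if i then 3 * h - beta_z c s else beta_z c s.
Proof.
rewrite curve_planar; move: (beta_x c s) (beta_z c s) => x z.
by case: i; rewrite /planar !coordE; ring.
Qed.

Lemma endpoint_height e : beta_z c (if e then 8 else 0) = - c.
Proof.
case: e.
  by have [_ -> _ _] := @last_segment R c 8 ltac:(lra); rewrite subrr mulr0 addr0.
by have [_ -> _ _] := @first_segment R c 0 ltac:(lra); rewrite mulr0 addr0.
Qed.

Lemma granny_wallE j : @obstacle R L j = wall j (if j then 3 * h + c else c).
Proof. by apply/funext => p; rewrite /wall /=; case: j. Qed.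

Lemma granny_generalized_link : generalized_link L.
Proof.
split.
- move=> i; split => //.
  + exact: (continuous_curve (i := i)).
  + exact: granny_tangent_of_BV.
- move=> i1 i2 s1 s2 i12; rewrite !in_itv/= => s1I s2I E.
  have := curve_dist_ge1 c0 i1 s1I s2I.
  have -> : ~~ i1 = i2 by case: i1 i2 i12 {E} => -[].
  rewrite (_ : curve_of c i1 s1 - curve_of c i2 s2 = 0); last first.
    by apply/eqP; rewrite subr_eq0; apply/eqP.
  rewrite /enorm (_ : dot 0 0 = 0) ?sqrtr0 ?ler10//.
  by rewrite /dot big1// => k _; rewrite !mxE mul0r.
- move=> i e _; apply/in_horizontal_plane.
  rewrite (z_curve i (if e then 8 else 0)) endpoint_height.
  by case: i; rewrite ?opprK.
- move=> j; rewrite granny_wallE; split; [exact: wall_C1|exact: wall_regular].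
- move=> i j s; rewrite granny_wallE => sI.
  have s08 : 0 <= s <= 8 by move: sI; rewrite in_itv.
  have bh := beta_height c0 s08; have cge := ltW c0; have zE := z_curve i s.
  suff : 0 <= wall j (if j then 3 * h + c else c) (curve_of c i s) by [].
  by rewrite /wall zE; case: j; case: {zE sI} i; lra.
Qed.

(** The infimum is attained at the foot (1, 0, 0) of an arc of beta and the tip
    (0, 0, 0) of gamma. *)
Lemma granny_GThi : @GThi R L = 1%:E.
Proof.
apply/eqP; rewrite eq_le; apply/andP; split.
- apply: ereal_inf_lbound; exists false, true, 1, 4; split => //=.
  + by rewrite in_itv/=; lra.
  + by rewrite in_itv/=; lra.
  + congr EFin; apply/esym/eqP; rewrite -(eqrXn2 (n := 2))// ?sqrtr_ge0//.
    rewrite (curve_dist_sqr c false) expr1n.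
    have [-> -> _ _] := @first_segment R c 1 ltac:(lra).
    rewrite (piece_x (clasp_piece4 c)) ?(piece_z (clasp_piece4 c)); [|lra|lra].
    by rewrite subrr mulr0 clasp_X0 clasp_Z0; apply/eqP; ring.
- apply: le_ereal_inf_tmp => _ [i1 [i2 [s1 [s2 [i12 + + ->]]]]].
  rewrite !in_itv/= => s1I s2I; rewrite lee_fin.
  have -> : i2 = ~~ i1 by case: i1 i2 i12 => -[].
  exact: curve_dist_ge1.
Qed.

End GrannyLink.

(** * Integrals along a planar curve *)

Section PlanarIntegral.
Context {R : realType}.
Implicit Types (a b : R) (i : bool) (xi T : R -> 'rV[R]_3).
Local Notation BV := bounded_variation.

(** Only the projection of xi to the plane of the curve enters, and each of the
    two coordinates is a scalar Stieltjes integral. *)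
Lemma is_RS_integral_planar i xi (tx tz : R -> R) a b vx vz : a <= b ->
  continuous (along i \o xi) -> continuous (up i \o xi) ->
  BV a b tx -> BV a b tz ->
  has_stieltjes a b (along i \o xi) tx vx ->
  has_stieltjes a b (up i \o xi) tz vz ->
  is_RS_integral a b xi (fun s => planar i (tx s) (tz s)) (vx + vz).
Proof.
move=> ab cx cz bx bz hx hz e e0.
have e2 : 0 < e / 2 by rewrite divr_gt0.
have [d1 d10 H1] := stieltjes_sum_cvg cx bx ab hx e2.
have [d2 d20 H2] := stieltjes_sum_cvg cz bz ab hz e2.
exists (Num.min d1 d2); first by rewrite lt_min d10.
move=> s tag abs tags.
under eq_bigr do rewrite planarB dot_planar.
rewrite big_split/= opprD addrACA (le_lt_trans (ler_normD _ _))//.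
rewrite [ltRHS]splitr ltrD//.
- apply: H1 => // k /tags[? ?]; rewrite lt_min => /andP[? _]; split=> //.
- apply: H2 => // k /tags[? ?]; rewrite lt_min => /andP[_ ?]; split=> //.
Qed.

Lemma is_RS_integral_eq xi xi' T T' a b v :
  (forall s, a <= s <= b -> xi s = xi' s) ->
  (forall s, a <= s <= b -> T s = T' s) ->
  is_RS_integral a b xi T v -> is_RS_integral a b xi' T' v.
Proof.
move=> xiE TE H e e0; have [d d0 Hd] := H e e0; exists d => // s tag abs tags.
have pt m : (m <= size s)%N -> a <= nth b (a :: s) m <= b.
  by move=> ms; rewrite itv_partition_nth_ge ?itv_partition_nth_le.
have := Hd s tag abs tags; congr (`|_ - v| < e).
apply: eq_big_nat => k /andP[_ ks].
have /andP[al _] := pt k (ltnW ks); have /andP[_ br] := pt k.+1 ks.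
have [ta tb _] := tags k ks.
rewrite xiE; last by rewrite (le_trans al ta) (le_trans tb br).
by rewrite (TE _ (pt _ (ltnW ks))) (TE _ (pt k.+1 ks)).
Qed.

Lemma continuous_along i : continuous (@along R i).
Proof. by case: i => p; exact: coord_continuous. Qed.

Lemma continuous_up i : continuous (@up R i).
Proof.
have cz : continuous (@z_of R) by move=> p; exact: coord_continuous.
by case: i => p; [exact: cvgN (cz p)|exact: cz].
Qed.

Lemma has_stieltjes_cst a b (f G : R -> R) (k : R) :
  (forall s, a <= s <= b -> G s = k) -> has_stieltjes a b f G 0.
Proof.
move=> Gk; rewrite -(subrr (0 : R)).
apply: (@has_stieltjes_mean_value _ _ _ _ _ (fun=> 0)).
move=> x y ax xy yb; exists x; first by rewrite lexx.
by rewrite !Gk ?subrr ?mulr0// ?ax ?(le_trans ax xy)// (le_trans xy yb).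
Qed.

End PlanarIntegral.

(** * The balance of forces in a clasp *)

Section Balance.
Context {R : realType}.
Implicit Types (f g Q : R -> R) (u : R).
Local Notation X := (clasp_X (R := R)).
Local Notation tx := (tangent_x (R := R)).
Local Notation tz := (tangent_z (R := R)).
Local Notation h := (clasp_h R).

(** Q is an indefinite integral of the density e, which may be unbounded at 0 and
    at 1. *)
Definition arc_energy Q (e : R -> R) : Prop :=
  (forall u, 0 <= u <= 1 -> {for u, continuous Q}) /\
  forall u : R, 0 < u < 1 -> is_derive u 1 Q (e u).

(** The density in u of the contribution of an arc to the variation of length: the
    scalar product of the field (f, g) with - dT / du = (sigma slope, - kappa). *)
Definition arc_load f g p q sigma kappa u : R :=
  sigma * slope u * f (p + q * u) - kappa * g (p + q * u).

Lemma piece_force c f g lo hi p q sigma kappa C : continuous f -> continuous g ->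
  clasp_piece c lo p q sigma kappa C -> hi = lo + 1 ->
  exists Q (vx vz : R), [/\ arc_energy Q (arc_load f g p q sigma kappa),
    has_stieltjes lo hi f tx vx, has_stieltjes lo hi g tz vz
    & vx + vz = - (Q 1 - Q 0)].
Proof.
move=> cf cg [pq _ _ _ _ txE tzE] ->.
by have [Q [vx [vz [cQ dQ hx hz E]]]] := arc_force cf cg pq txE tzE; exists Q, vx, vz.
Qed.

(** The arcs are grouped in mirror pairs: 1 and 6 are at the level [0, h], 2 and 5
    at [h, 2h], 3 and 4 at [2h, 3h]. *)
Lemma beta_force (c : R) f g : continuous f -> continuous g ->
  exists Q1 Q2 Q3 Q4 Q5 Q6 (vx vz : R),
  [/\ has_stieltjes 0 8 f tx vx /\ has_stieltjes 0 8 g tz vz,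
      - (vx + vz) = (Q1 1 - Q1 0) + (Q2 1 - Q2 0) + (Q3 1 - Q3 0) +
        (Q4 1 - Q4 0) + (Q5 1 - Q5 0) + (Q6 1 - Q6 0),
      arc_energy Q1 (arc_load f g 2 (-1) 1 (-1)) /\
      arc_energy Q6 (arc_load f g 6 1 (-1) (-1)),
      arc_energy Q2 (arc_load f g 2 1 (-1) 1) /\
      arc_energy Q5 (arc_load f g 6 (-1) 1 1)
    & arc_energy Q3 (arc_load f g 4 (-1) (-1) (-1)) /\
      arc_energy Q4 (arc_load f g 4 1 1 (-1))].
Proof.
move=> cf cg.
have x0 : has_stieltjes 0 1 f tx 0.
  by apply: (@has_stieltjes_cst _ _ _ _ _ 0) => s /(first_segment c)[].
have z0 : has_stieltjes 0 1 g tz 0.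
  by apply: (@has_stieltjes_cst _ _ _ _ _ 1) => s /(first_segment c)[].
have x7 : has_stieltjes 7 8 f tx 0.
  by apply: (@has_stieltjes_cst _ _ _ _ _ 0) => s /(last_segment c)[].
have z7 : has_stieltjes 7 8 g tz 0.
  by apply: (@has_stieltjes_cst _ _ _ _ _ (-1)) => s /(last_segment c)[].
have [Q1 [x1 [z1 [A1 hx1 hz1 E1]]]] :=
  piece_force (hi := 2) cf cg (clasp_piece1 c) ltac:(lra).
have [Q2 [x2 [z2 [A2 hx2 hz2 E2]]]] :=
  piece_force (hi := 3) cf cg (clasp_piece2 c) ltac:(lra).
have [Q3 [x3 [z3 [A3 hx3 hz3 E3]]]] :=
  piece_force (hi := 4) cf cg (clasp_piece3 c) ltac:(lra).
have [Q4 [x4 [z4 [A4 hx4 hz4 E4]]]] :=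
  piece_force (hi := 5) cf cg (clasp_piece4 c) ltac:(lra).
have [Q5 [x5 [z5 [A5 hx5 hz5 E5]]]] :=
  piece_force (hi := 6) cf cg (clasp_piece5 c) ltac:(lra).
have [Q6 [x6 [z6 [A6 hx6 hz6 E6]]]] :=
  piece_force (hi := 7) cf cg (clasp_piece6 c) ltac:(lra).
exists Q1, Q2, Q3, Q4, Q5, Q6, (0 + x1 + x2 + x3 + x4 + x5 + x6 + 0),
  (0 + z1 + z2 + z3 + z4 + z5 + z6 + 0); split => //; last by lra.
split.
- apply: (has_stieltjes_cat _ _ _ x7); [lra|lra|].
  apply: (has_stieltjes_cat _ _ _ hx6); [lra|lra|].
  apply: (has_stieltjes_cat _ _ _ hx5); [lra|lra|].
  apply: (has_stieltjes_cat _ _ _ hx4); [lra|lra|].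
  apply: (has_stieltjes_cat _ _ _ hx3); [lra|lra|].
  apply: (has_stieltjes_cat _ _ _ hx2); [lra|lra|].
  apply: (has_stieltjes_cat _ _ _ hx1); [lra|lra|].
  exact: x0.
- apply: (has_stieltjes_cat _ _ _ z7); [lra|lra|].
  apply: (has_stieltjes_cat _ _ _ hz6); [lra|lra|].
  apply: (has_stieltjes_cat _ _ _ hz5); [lra|lra|].
  apply: (has_stieltjes_cat _ _ _ hz4); [lra|lra|].
  apply: (has_stieltjes_cat _ _ _ hz3); [lra|lra|].
  apply: (has_stieltjes_cat _ _ _ hz2); [lra|lra|].
  apply: (has_stieltjes_cat _ _ _ hz1); [lra|lra|].
  exact: z0.
Qed.

(** After multiplication by clasp_gap u the right-hand side is
    clasp_gap u + X u + X (1 - u), the sum of three numbers of [0, 1] whose squares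
    add up to 1. *)
Lemma clasp_gap_slopes u : 0 < u < 1 ->
  (clasp_gap u)^-1 <= 1 + slope u + slope (1 - u).
Proof.
move=> u01; have g0 := clasp_gap_gt0 u01.
have xu := @clasp_gap_slope R u ltac:(lra).
have xv := @clasp_gap_slope R (1 - u) ltac:(lra).
rewrite clasp_gap_onem in xv.
have sq := @sqr_clasp_gap R u ltac:(lra).
rewrite -[leLHS]mul1r ler_pdivrMr// !mulrDl mul1r -xu -xv.
have := clasp_X_ge0 u; have := clasp_X_ge0 (1 - u).
have := @clasp_X_le1 R u ltac:(lra); have := @clasp_X_le1 R (1 - u) ltac:(lra).
have g1 : clasp_gap u <= 1.
  rewrite -[leRHS]sqrtr1 ler_wsqrtr//.
  by have := sqr_ge0 (X u); have := sqr_ge0 (X (1 - u)); lra.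
nra.
Qed.

(** The function Psi below is nondecreasing: adding 2 eps (1 + slope u +
    slope (1 - u)) makes the total load nonnegative. The primitive
    u + cosine (1 - u) - cosine u of that bracket increases by 3, which gives 6 eps. *)
Lemma clasp_balance (eps : R) Qa Qa' Qb Qb' (ea ea' eb eb' : R -> R) : 0 <= eps ->
  arc_energy Qa ea -> arc_energy Qa' ea' ->
  arc_energy Qb eb -> arc_energy Qb' eb' ->
  (forall u, 0 < u < 1 -> - (2 * eps) / clasp_gap u <=
    ea u + ea' u + eb (1 - u) + eb' (1 - u)) ->
  - (6 * eps) <= (Qa 1 - Qa 0) + (Qa' 1 - Qa' 0) + (Qb 1 - Qb 0) + (Qb' 1 - Qb' 0).
Proof.
move=> eps0 [ca da] [ca' da'] [cb db] [cb' db'] load.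
pose Psi u := Qa u + Qa' u - Qb (1 - u) - Qb' (1 - u) +
  2 * eps * (u + cosine (1 - u) - cosine u).
pose dPsi u := ea u + ea' u + eb (1 - u) + eb' (1 - u) +
  2 * eps * (1 + slope u + slope (1 - u)).
have cid : continuous (fun u : R => u) by move=> ?; exact: cvg_id.
have cv : continuous (fun u : R => 1 - u).
  by move=> u; apply: cvgB; [exact: cvg_cst|exact: cvg_id].
have crev Q u : (forall u, 0 <= u <= 1 -> {for u, continuous Q}) ->
    0 <= u <= 1 -> {for u, continuous (fun u => Q (1 - u))}.
  move=> cQ u01; apply: (@continuous_comp _ _ _ (fun u => 1 - u) Q); first exact: cv.
  by apply: cQ; lra.
have : Psi 0 <= Psi 1.
  apply: (@derive_ge0_le _ Psi dPsi 0 1 ler01) => u u01.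
  - have v01 : 0 < 1 - u < 1 by lra.
    have dv : is_derive u 1 (fun x : R => 1 - x) (-1).
      by apply: is_derive_eq; ring.
    have d1 := da _ u01; have d2 := da' _ u01.
    have d3 : is_derive u 1 (fun u => Qb (1 - u)) _ :=
      is_derive1_comp (f := Qb) (g := fun x : R => 1 - x) (db _ v01) dv.
    have d4 : is_derive u 1 (fun u => Qb' (1 - u)) _ :=
      is_derive1_comp (f := Qb') (g := fun x : R => 1 - x) (db' _ v01) dv.
    have d5 := is_derive_cosine u01.
    have d6 : is_derive u 1 (fun u => cosine (1 - u)) _ :=
      is_derive1_comp (f := cosine) (g := fun x : R => 1 - x) (is_derive_cosine v01) dv.
    rewrite /Psi; apply: is_derive_eq; rewrite /dPsi /slope /GRing.scale/=; ring.
  - apply: continuousD; first apply: continuousB; first apply: continuousB;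
      first apply: continuousD.
    + exact: ca.
    + exact: ca'.
    + exact: crev.
    + exact: crev.
    + apply: continuousM; first exact: cst_continuous.
      apply: continuousB; last exact: continuous_cosine.
      apply: continuousD; first exact: cid.
      by apply: crev => // w _; exact: continuous_cosine.
  - have := load u u01; have := clasp_gap_slopes u01; rewrite /dPsi.
    move: (clasp_gap u)^-1 (1 + _ + _) (ea u + _ + _ + _) => i K e iK le.
    have : 0 <= eps * (K - i) by rewrite mulr_ge0// subr_ge0.
    by rewrite mulrBr mulNr in le *; lra.
rewrite /Psi !subr0 !subrr !cosine0 !cosine1; lra.
Qed.

End Balance.

(** * Strong criticality *)

Section Criticality.
Context {R : realType}.
Variable c : R.
Hypothesis c0 : 0 < c.
Implicit Types (u s eps : R).
Local Notation X := (clasp_X (R := R)).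
Local Notation h := (clasp_h R).
Local Notation L := (granny_clasp c).
Variable xi : bool -> R -> 'rV[R]_3.

(** The field is frozen beyond the ends of the parameter interval, so that it is
    continuous on the whole line. *)
Definition along_field i s : R := along i (xi i (clip 0 8 s)).
Definition up_field i s : R := up i (xi i (clip 0 8 s)).

Lemma segment_itv (lo s : R) : 0 <= lo <= 7 -> lo <= s <= lo + 1 -> 0 <= s <= 8.
Proof. by move=> *; lra. Qed.

(** The condition on C and C' says that the two arcs face each other in a clasp,
    where the strut from gamma to beta is the unit vector
    (sigma X u, - sigma' X (1 - u), - kappa clasp_gap u). *)
Lemma clasp_strut_dot lo p q sigma kappa C lo' p' q' sigma' C' u eps s s' :
  clasp_piece c lo p q sigma kappa C -> clasp_piece c lo' p' q' sigma' kappa C' ->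
  0 <= lo <= 7 -> 0 <= lo' <= 7 -> C + C' - 3 * h = - kappa * h ->
  ((- eps)%:E <= @delta_GThi R L xi)%E -> 0 < u < 1 ->
  s = p + q * u -> s' = p' + q' * (1 - u) ->
  - eps <= sigma * X u * (along_field false s - x1_of (xi true (clip 0 8 s')))
    + sigma' * X (1 - u) * (along_field true s' - x2_of (xi false (clip 0 8 s)))
    - kappa * clasp_gap u * (up_field false s + up_field true s').
Proof.
move=> [pq sg kp xE zE _ _] [pq' sg' _ xE' zE' _ _] lo07 lo07' CC le u01 sE s'E.
have u01' : 0 <= u <= 1 by case/andP: u01 => /ltW -> /ltW ->.
have sI : lo <= s <= lo + 1.
  by rewrite sE; case: pq {xE zE} => -[-> ->]; lra.
have sI' : lo' <= s' <= lo' + 1.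
  by rewrite s'E; case: pq' {xE' zE'} => -[-> ->]; lra.
have us : q * (s - p) = u.
  by rewrite sE; case: pq => -[-> _]; ring.
have us' : q' * (s' - p') = 1 - u.
  by rewrite s'E; case: pq' => -[-> _]; ring.
have {xE} xs : beta_x c s = sigma * X u by rewrite xE// us.
have {zE} zs : beta_z c s = C + kappa * clasp_Z u by rewrite zE// us.
have {xE'} xs' : beta_x c s' = sigma' * X (1 - u) by rewrite xE'// us'.
have {zE'} zs' : beta_z c s' = C' + kappa * clasp_Z (1 - u) by rewrite zE'// us'.
have zz : beta_z c s + beta_z c s' - 3 * h = - kappa * clasp_gap u.
  have CE : C = 3 * h - kappa * h - C' by rewrite -mulNr -CC; ring.
  rewrite (clasp_gapE u01') zs zs' CE; ring.
have dist1 : enorm (curve_of c false s - curve_of c true s') = 1.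
  apply/eqP; rewrite -(eqrXn2 (n := 2))// ?sqrtr_ge0//.
  rewrite (curve_dist_sqr c false) zz xs xs' expr1n !exprMn sqrrN.
  have := sqr_clasp_gap u01'.
  move: (X u) (X (1 - u)) (clasp_gap u) => x x' g ->.
  by rewrite (sqr_unit sg) (sqr_unit sg') (sqr_unit kp); apply/eqP; ring.
have s08 := segment_itv lo07 sI; have s08' := segment_itv lo07' sI'.
rewrite /along_field /up_field !clip_id//.
have strut : @gehring_strut R L false s true s'.
  by split => //; rewrite granny_GThi//; congr EFin.
have := le_trans le (ereal_inf_lbound _).
move=> /(_ _ (ex_intro _ false (ex_intro _ s (ex_intro _ true (ex_intro _ s'
  (conj strut erefl)))))).
rewrite lee_fin /normalize -/(curve_of c false) -/(curve_of c true).
rewrite [enorm _]dist1 invr1 scale1r => /le_trans; apply.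
have -> : curve_of c false s - curve_of c true s' =
    vec3 (sigma * X u) (- (sigma' * X (1 - u))) (- kappa * clasp_gap u).
  rewrite !curve_planar xs xs' -zz; move: (beta_z c s) (beta_z c s') => z z'.
  by rewrite /planar; apply: row3P; rewrite !coordE; ring.
rewrite dotE !coordE /along /up.
by rewrite le_eqVlt; apply/orP; left; apply/eqP; ring.
Qed.

(** In the sum over the four struts the normal components of xi, which carry the
    signs sigma and sigma', cancel; in the in-plane components each point counts
    twice. Dividing by 2 clasp_gap u yields the loads, by clasp_gap_slope. *)
Lemma clasp_energy_ge kappa C C' eps lo1 p1 q1 lo2 p2 q2 lo3 p3 q3 lo4 p4 q4
    Q1 Q2 Q3 Q4 :
  clasp_piece c lo1 p1 q1 1 kappa C -> clasp_piece c lo2 p2 q2 (-1) kappa C ->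
  clasp_piece c lo3 p3 q3 1 kappa C' -> clasp_piece c lo4 p4 q4 (-1) kappa C' ->
  0 <= lo1 <= 7 -> 0 <= lo2 <= 7 -> 0 <= lo3 <= 7 -> 0 <= lo4 <= 7 ->
  C + C' - 3 * h = - kappa * h ->
  0 <= eps -> ((- eps)%:E <= @delta_GThi R L xi)%E ->
  arc_energy Q1 (arc_load (along_field false) (up_field false) p1 q1 1 kappa) ->
  arc_energy Q2 (arc_load (along_field false) (up_field false) p2 q2 (-1) kappa) ->
  arc_energy Q3 (arc_load (along_field true) (up_field true) p3 q3 1 kappa) ->
  arc_energy Q4 (arc_load (along_field true) (up_field true) p4 q4 (-1) kappa) ->
  - (6 * eps) <= (Q1 1 - Q1 0) + (Q2 1 - Q2 0) + (Q3 1 - Q3 0) + (Q4 1 - Q4 0).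
Proof.
move=> P1 P2 P3 P4 l1 l2 l3 l4 CC eps0 le E1 E2 E3 E4.
apply: clasp_balance E1 E2 E3 E4 _ => // u u01.
have g0 := clasp_gap_gt0 u01.
rewrite ler_pdivrMr// /arc_load.
have I13 := clasp_strut_dot P1 P3 l1 l3 CC le u01 erefl erefl.
have I14 := clasp_strut_dot P1 P4 l1 l4 CC le u01 erefl erefl.
have I23 := clasp_strut_dot P2 P3 l2 l3 CC le u01 erefl erefl.
have I24 := clasp_strut_dot P2 P4 l2 l4 CC le u01 erefl erefl.
have Xu := @clasp_gap_slope R u ltac:(lra).
have Xv := @clasp_gap_slope R (1 - u) ltac:(lra).
rewrite clasp_gap_onem in Xv.
have sum := lerD (lerD I13 I14) (lerD I23 I24); rewrite Xu Xv in sum.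
rewrite -(ler_pM2r (x := 2))//.
have -> : - (2 * eps) * 2 = - eps + - eps + (- eps + - eps) by ring.
by apply: (le_trans sum); rewrite le_eqVlt; apply/orP; left; apply/eqP; ring.
Qed.

Hypothesis xiP : @compatible R L xi.

(** The tangents at the ends are vertical and the field is horizontal: there is no
    boundary term. *)
Lemma endpoint_up i (e : bool) : up i (xi i (if e then 8 else 0)) = 0.
Proof.
have [_ _ /(_ i e isT)] := xiP; rewrite in_horizontal_direction => /eqP.
by rewrite /up => ->; rewrite oppr0; case: i.
Qed.

Lemma granny_delta_Len_comp i vx vz :
  has_stieltjes 0 8 (along_field i) (@tangent_x R) vx ->
  has_stieltjes 0 8 (up_field i) (@tangent_z R) vz ->
  @delta_Len_comp R L xi i = - (vx + vz).
Proof.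
move=> hx hz; rewrite /delta_Len_comp.
have -> : @unit_tangent R L i (@hi R L i) = curve_tangent i 8.
  by apply: (@granny_unit_tangent R c c0 i 8); lra.
have -> : @unit_tangent R L i (@Defs.lo R L i) = curve_tangent i 0.
  by apply: (@granny_unit_tangent R c c0 i 0); lra.
have [_ _ t8 w8] := @last_segment R c 8 ltac:(lra).
have [_ _ t0 w0] := @first_segment R c 0 ltac:(lra).
have d8 : dot (curve_tangent i 8) (xi i 8) = 0.
  rewrite /dot; under eq_bigr do rewrite mulrC.
  by rewrite -/(dot _ _) dot_planar t8 w8 (endpoint_up i true); ring.
have d0 : dot (curve_tangent i 0) (xi i 0) = 0.
  rewrite /dot; under eq_bigr do rewrite mulrC.
  by rewrite -/(dot _ _) dot_planar t0 w0 (endpoint_up i false); ring.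
rewrite /= d8 d0 subrr sub0r; congr (- _).
have [cxi _ _] := xiP.
have cc : continuous (xi i \o clip 0 8).
  by apply: continuous_comp_clip; [lra|exact: cxi].
apply: is_RS_integral_unique; first by lra.
apply: (@is_RS_integral_eq _ (xi i \o clip 0 8) _ (curve_tangent i)).
- by move=> s s08; rewrite /= clip_id.
- by move=> s s08; rewrite granny_unit_tangent.
apply: is_RS_integral_planar => //.
- by move=> s; apply: continuous_comp; [exact: cc|exact: continuous_along].
- by move=> s; apply: continuous_comp; [exact: cc|exact: continuous_up].
- exact: bounded_variation_tangent_x.
- exact: bounded_variation_tangent_z.
Qed.

(** The pairs of arcs 1 and 6 of beta face the arcs 3 and 4 of gamma, 2 and 5 face
    2 and 5, and 3 and 4 face 1 and 6, so every arc occurs in exactly one of the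
    three clasps. *)
Lemma granny_delta_Len_ge eps : 0 <= eps ->
  ((- eps)%:E <= @delta_GThi R L xi)%E -> - (18 * eps) <= @delta_Len R L xi.
Proof.
move=> eps0 le.
have [cxi _ _] := xiP.
have cc i : continuous (xi i \o clip 0 8).
  by apply: continuous_comp_clip; [lra|exact: cxi].
have ca i : continuous (along_field i).
  by move=> s; apply: (continuous_comp (cc i s)); exact: continuous_along.
have cu i : continuous (up_field i).
  by move=> s; apply: (continuous_comp (cc i s)); exact: continuous_up.
have [A1 [A2 [A3 [A4 [A5 [A6 [ax [az [[hax haz] EA [a1 a6] [a2 a5] [a3 a4]]]]]]]]]] :=
  beta_force c (ca false) (cu false).
have [B1 [B2 [B3 [B4 [B5 [B6 [bx [bz [[hbx hbz] EB [b1 b6] [b2 b5] [b3 b4]]]]]]]]]] :=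
  beta_force c (ca true) (cu true).
have -> : @delta_Len R L xi =
    @delta_Len_comp R L xi true + @delta_Len_comp R L xi false.
  exact: big_bool.
rewrite (granny_delta_Len_comp hax haz) (granny_delta_Len_comp hbx hbz) EA EB.
have low := clasp_energy_ge (clasp_piece1 c) (clasp_piece6 c)
  (clasp_piece4 c) (clasp_piece3 c) ltac:(lra) ltac:(lra) ltac:(lra) ltac:(lra)
  ltac:(lra) eps0 le a1 a6 b4 b3.
have mid := clasp_energy_ge (clasp_piece5 c) (clasp_piece2 c)
  (clasp_piece5 c) (clasp_piece2 c) ltac:(lra) ltac:(lra) ltac:(lra) ltac:(lra)
  ltac:(lra) eps0 le a5 a2 b5 b2.
have top := clasp_energy_ge (clasp_piece4 c) (clasp_piece3 c)
  (clasp_piece1 c) (clasp_piece6 c) ltac:(lra) ltac:(lra) ltac:(lra) ltac:(lra)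
  ltac:(lra) eps0 le a4 a3 b1 b6.
lra.
Qed.

End Criticality.

Theorem theorem7p1 (R : realType) (c : R) (hc : 0 < c) :
  generalized_link (granny_clasp c) /\ strongly_critical (granny_clasp c).
Proof.
split; first exact: granny_generalized_link.
(* 36 is twice the 18 of granny_delta_Len_ge, which leaves - 1 / 2 > - 1 *)
exists (36^-1); first by rewrite invr_gt0.
move=> xi xiP len; rewrite leNgt; apply/negP => lt.
have := @granny_delta_Len_ge R c hc xi xiP 36^-1.
rewrite len => H.
have /H : (0 : R) <= 36^-1 by rewrite invr_ge0.
have le : ((- 36^-1)%:E <= @delta_GThi R (granny_clasp c) xi)%E.
  by apply: ltW; apply: lt_le_trans lt _; rewrite ge_min lexx.
move=> /(_ le); lra.
Qed.
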